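(* Let $X_{\{3,3,4\}}$, $X_{\{3,4,3\}}$ and $X_{\{3,3,5\}}$ denote the 16-cell quandle, the 24-cell quandle and the 600-cell quandle respectively, and for $m\ge 1$ let $Q_m$ denote the knot quandle of the $m$-twist-spun trefoil. Then there are isomorphisms of quandles $$X_{\{3,3,4\}}\cong Q_3,\qquad X_{\{3,4,3\}}\cong Q_4,\qquad X_{\{3,3,5\}}\cong Q_5 .$$
   Context: **Quandles.** A quandle is a non-empty set $X$ with a binary operation $\ast$ such that (Q1) $x\ast x=x$ for all $x$; (Q2) for each $x\in X$ the map $w\mapsto w\ast x$ is a bijection of $X$; (Q3) $(x\ast y)\ast z=(x\ast z)\ast(y\ast z)$ for all $x,y,z$. A homomorphism of quandles is a map preserving $\ast$; an isomorphism is a bijective homomorphism. **Knot quandle of the $m$-twist-spun trefoil.** The $m$-twist-spun trefoil is a fibered 2-knot. Let $G_m$ be the fundamental group of its fiber and $\varphi$ the automorphism of $G_m$ given by the monodromy. Explicitly, $$G_m=\langle \gamma_1,\dots,\gamma_m \mid \gamma_1=\gamma_2\gamma_m,\ \gamma_2=\gamma_3\gamma_1,\ \dots,\ \gamma_{m-1}=\gamma_m\gamma_{m-2},\ \gamma_m=\gamma_1\gamma_{m-1}\rangle$$ (that is, $\gamma_i=\gamma_{i+1}\gamma_{i-1}$ with indices modulo $m$), and $\varphi(\gamma_i)=\gamma_{i+1}$ for $1\le i\le m-1$, $\varphi(\gamma_m)=\gamma_1$. The knot quandle $Q_m$ is the set $G_m$ with the operation $x\ast y=\varphi(xy^{-1})\,y$.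 **16-, 24- and 600-cell quandles.** Let $\boldsymbol e_1,\dots,\boldsymbol e_4$ be the standard basis (column vectors) of $\mathbb R^4$, $\phi=(1+\sqrt5)/2$, and $A_4$ the alternating group on $\{1,2,3,4\}$. Put - $V_{\{3,3,4\}}=\{\pm\boldsymbol e_1,\pm\boldsymbol e_2,\pm\boldsymbol e_3,\pm\boldsymbol e_4\}$, - $V_{\{3,4,3\}}=\{\pm\boldsymbol e_i\pm\boldsymbol e_j\mid 1\le i<j\le4\}$, - $V_{\{3,3,5\}}=\{\pm\boldsymbol e_1,\pm\boldsymbol e_2,\pm\boldsymbol e_3,\pm\boldsymbol e_4\}\cup\{\tfrac12(\pm\boldsymbol e_1\pm\boldsymbol e_2\pm\boldsymbol e_3\pm\boldsymbol e_4)\}\cup\{\tfrac12(\pm\phi\,\boldsymbol e_{\sigma(1)}\pm\boldsymbol e_{\sigma(2)}\pm\phi^{-1}\boldsymbol e_{\sigma(3)})\mid\sigma\in A_4\}$ (all sign choices independent). These are the vertex sets of the regular tessellations $\{3,3,4\}$, $\{3,4,3\}$, $\{3,3,5\}$ of the 3-sphere (16-, 24-, 600-cell), up to scaling. For $S\in\{\{3,3,4\},\{3,4,3\},\{3,3,5\}\}$ and $v\in V_S$ a $4\times4$ matrix $R_v$ is given below; let $r_v(\boldsymbol x)=R_v\boldsymbol x$. One has $r_v(v)=v$, $r_v(V_S)=V_S$ and $r_{r_w(v)}=r_w\circ r_v\circ r_w^{-1}$ for all $v,w\in V_S$. The 16-, 24-, 600-cell quandle is respectively the set $X_S=\{(v,r_v)\mid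 v\in V_S\}$ with operation $(v,r_v)\ast(w,r_w)=(r_w(v),r_{r_w(v)})$. In all cases $R_{-v}=R_v$; below vectors are written as $(x_1,x_2,x_3,x_4)=\sum_i x_i\boldsymbol e_i$. *$S=\{3,3,4\}$:* $R_{\pm \boldsymbol e_1}=\begin{pmatrix}1&0&0&0\\0&0&0&1\\0&1&0&0\\0&0&1&0\end{pmatrix}$, $R_{\pm \boldsymbol e_2}=\begin{pmatrix}0&0&-1&0\\0&1&0&0\\0&0&0&-1\\1&0&0&0\end{pmatrix}$, $R_{\pm \boldsymbol e_3}=\begin{pmatrix}0&0&0&-1\\1&0&0&0\\0&0&1&0\\0&-1&0&0\end{pmatrix}$, $R_{\pm \boldsymbol e_4}=\begin{pmatrix}0&-1&0&0\\0&0&-1&0\\1&0&0&0\\0&0&0&1\end{pmatrix}$. *$S=\{3,4,3\}$:* - $v=\pm(\boldsymbol e_1+\boldsymbol e_2),\pm(\boldsymbol e_1-\boldsymbol e_2)$: $R_v=\begin{pmatrix}1&0&0&0\\0&1&0&0\\0&0&0&-1\\0&0&1&0\end{pmatrix}$; - $v=\pm(\boldsymbol e_3+\boldsymbol e_4),\pm(\boldsymbol e_3-\boldsymbol e_4)$: $R_v=\begin{pmatrix}0&-1&0&0\\1&0&0&0\\0&0&1&0\\0&0&0&1\end{pmatrix}$; - $v=\pm(\boldsymbol e_1+\boldsymbol e_3),\pm(\boldsymbol e_2+\boldsymbol e_4)$: $R_v=\frac12\begin{pmatrix}1&-1&1&1\\1&1&-1&1\\1&1&1&-1\\-1&1&1&1\end{pmatrix}$;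 - $v=\pm(\boldsymbol e_1-\boldsymbol e_3),\pm(\boldsymbol e_2-\boldsymbol e_4)$: $R_v=\frac12\begin{pmatrix}1&-1&-1&-1\\1&1&1&-1\\-1&-1&1&-1\\1&-1&1&1\end{pmatrix}$; - $v=\pm(\boldsymbol e_1+\boldsymbol e_4),\pm(\boldsymbol e_2-\boldsymbol e_3)$: $R_v=\frac12\begin{pmatrix}1&-1&-1&1\\1&1&-1&-1\\1&-1&1&-1\\1&1&1&1\end{pmatrix}$; - $v=\pm(\boldsymbol e_2+\boldsymbol e_3),\pm(\boldsymbol e_1-\boldsymbol e_4)$: $R_v=\frac12\begin{pmatrix}1&-1&1&-1\\1&1&1&1\\-1&1&1&-1\\-1&-1&1&1\end{pmatrix}$. *$S=\{3,3,5\}$* (each item lists ten vertices $v$, i.e. five up to sign): - $v=\pm(1,0,0,0)$, $\pm\frac12(\phi,1,\phi^{-1},0)$, $\pm\frac12(\phi,-1,-\phi^{-1},0)$, $\pm\frac12(\phi^{-1},\phi,1,0)$, $\pm\frac12(\phi^{-1},-\phi,-1,0)$: $R_v=\frac12\begin{pmatrix}2&0&0&0\\0&1&\phi&-\phi^{-1}\\0&\phi&-\phi^{-1}&1\\0&\phi^{-1}&-1&-\phi\end{pmatrix}$; - $v=\pm(0,1,0,0)$, $\pm\frac12(1,\phi,0,\phi^{-1})$, $\pm\frac12(1,-\phi,0,\phi^{-1})$, $\pm\frac12(\phi,\phi^{-1},0,1)$, $\pm\frac12(\phi,-\phi^{-1},0,1)$: $R_v=\frac12\begin{pmatrix}1&0&\phi^{-1}&\phi\\0&2&0&0\\-\phi^{-1}&0&-\phi&1\\\phi&0&-1&-\phi^{-1}\end{pmatrix}$;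 - $v=\pm(0,0,1,0)$, $\pm\frac12(1,0,\phi^{-1},-\phi)$, $\pm\frac12(1,0,-\phi^{-1},-\phi)$, $\pm\frac12(\phi^{-1},0,\phi,-1)$, $\pm\frac12(\phi^{-1},0,-\phi,-1)$: $R_v=\frac12\begin{pmatrix}-\phi^{-1}&1&0&-\phi\\-1&-\phi&0&-\phi^{-1}\\0&0&2&0\\-\phi&\phi^{-1}&0&1\end{pmatrix}$; - $v=\pm(0,0,0,1)$, $\pm\frac12(0,1,-\phi,\phi^{-1})$, $\pm\frac12(0,1,-\phi,-\phi^{-1})$, $\pm\frac12(0,\phi^{-1},-1,\phi)$, $\pm\frac12(0,\phi^{-1},-1,-\phi)$: $R_v=\frac12\begin{pmatrix}-\phi&1&\phi^{-1}&0\\-1&-\phi^{-1}&-\phi&0\\-\phi^{-1}&-\phi&1&0\\0&0&0&2\end{pmatrix}$; - $v=\pm\frac12(1,1,-1,1)$, $\pm\frac12(1,0,-\phi^{-1},\phi)$, $\pm\frac12(0,\phi,-\phi^{-1},-1)$, $\pm\frac12(\phi^{-1},\phi,-1,0)$, $\pm\frac12(\phi^{-1},-1,0,\phi)$: $R_v=\frac12\begin{pmatrix}-\phi^{-1}&1&0&\phi\\0&1&-\phi&-\phi^{-1}\\-\phi&-1&-\phi^{-1}&0\\1&-1&-1&1\end{pmatrix}$; - $v=\pm\frac12(1,-1,-1,-1)$, $\pm\frac12(1,\phi^{-1},\phi,0)$, $\pm\frac12(\phi,-\phi^{-1},0,-1)$, $\pm\frac12(0,1,\phi,\phi^{-1})$,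 $\pm\frac12(\phi,0,1,-\phi^{-1})$: $R_v=\frac12\begin{pmatrix}1&0&\phi^{-1}&-\phi\\-1&-\phi^{-1}&\phi&0\\1&1&1&1\\-1&\phi&0&-\phi^{-1}\end{pmatrix}$; - $v=\pm\frac12(1,-1,1,-1)$, $\pm\frac12(1,-\phi^{-1},\phi,0)$, $\pm\frac12(0,\phi^{-1},1,\phi)$, $\pm\frac12(\phi^{-1},0,\phi,1)$, $\pm\frac12(\phi^{-1},-1,0,-\phi)$: $R_v=\frac12\begin{pmatrix}-\phi^{-1}&0&\phi&-1\\-\phi&-\phi^{-1}&0&1\\1&-1&1&1\\0&\phi&\phi^{-1}&1\end{pmatrix}$; - $v=\pm\frac12(1,-1,-1,1)$, $\pm\frac12(1,\phi,0,-\phi^{-1})$, $\pm\frac12(\phi,0,-1,\phi^{-1})$, $\pm\frac12(\phi,1,-\phi^{-1},0)$, $\pm\frac12(0,\phi,\phi^{-1},-1)$: $R_v=\frac12\begin{pmatrix}1&1&-1&1\\\phi^{-1}&1&0&-\phi\\-\phi&1&-\phi^{-1}&0\\0&-1&-\phi&-\phi^{-1}\end{pmatrix}$; - $v=\pm\frac12(1,1,-1,-1)$, $\pm\frac12(1,\phi^{-1},-\phi,0)$, $\pm\frac12(0,\phi^{-1},1,-\phi)$, $\pm\frac12(\phi^{-1},1,0,-\phi)$, $\pm\frac12(\phi^{-1},0,-\phi,1)$: $R_v=\frac12\begin{pmatrix}-\phi^{-1}&\phi&-1&0\\0&-\phi^{-1}&-1&-\phi\\-\phi&0&1&-\phi^{-1}\\-1&-1&-1&1\end{pmatrix}$;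 - $v=\pm\frac12(1,1,1,1)$, $\pm\frac12(1,-\phi,0,-\phi^{-1})$, $\pm\frac12(\phi,0,1,\phi^{-1})$, $\pm\frac12(0,\phi,\phi^{-1},1)$, $\pm\frac12(\phi,-1,\phi^{-1},0)$: $R_v=\frac12\begin{pmatrix}1&-\phi^{-1}&\phi&0\\-1&1&1&1\\1&0&-\phi^{-1}&\phi\\1&\phi&0&-\phi^{-1}\end{pmatrix}$; - $v=\pm\frac12(1,-1,1,1)$, $\pm\frac12(1,0,\phi^{-1},\phi)$, $\pm\frac12(0,\phi,-\phi^{-1},1)$, $\pm\frac12(\phi^{-1},1,0,\phi)$, $\pm\frac12(\phi^{-1},-\phi,1,0)$: $R_v=\frac12\begin{pmatrix}-\phi^{-1}&0&\phi&1\\-1&1&-1&1\\0&-\phi&-\phi^{-1}&1\\\phi&\phi^{-1}&0&1\end{pmatrix}$; - $v=\pm\frac12(1,1,1,-1)$, $\pm\frac12(1,-\phi^{-1},-\phi,0)$, $\pm\frac12(\phi,\phi^{-1},0,-1)$, $\pm\frac12(0,1,\phi,-\phi^{-1})$, $\pm\frac12(\phi,0,-1,-\phi^{-1})$: $R_v=\frac12\begin{pmatrix}1&1&-1&-1\\0&-\phi^{-1}&1&-\phi\\-\phi^{-1}&\phi&1&0\\-\phi&0&-1&-\phi^{-1}\end{pmatrix}$. *)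

(* Defs.v *)
From HB Require Import structures.
From mathcomp Require Import all_boot all_order all_algebra.
From mathcomp Require Import all_fingroup all_solvable.
From mathcomp Require Import boolp classical_sets reals.
From mathcomp Require Import generic_quotient ring lra.

Set Implicit Arguments.
Unset Strict Implicit.
Unset Printing Implicit Defensive.

Import Order.TTheory GRing.Theory Num.Theory.

Record quandle := Quandle {
  quandle_car :> Type;
  qop : quandle_car -> quandle_car -> quandle_car;
  quandle_inhabited : inhabited quandle_car;
  qopxx : forall x, qop x x = x;
  qop_bij : forall x, bijective (fun w => qop w x);
  qop_dist : forall x y z, qop (qop x y) z = qop (qop x z) (qop y z) }.

Definition quandle_hom (X Y : quandle) (f : X -> Y) :=
  forall x y, f (qop x y) = qop (f x) (f y).

Definition quandle_isomorphic (X Y : quandle) :=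
  exists f : X -> Y, bijective f /\ quandle_hom f.

Section PresentedGroup.
Variable I : choiceType.

(* The letter (i, false) stands for the generator i, (i, true) for its
   inverse. *)
Definition word : Type := seq (I * bool).
HB.instance Definition _ := Choice.on word.

Definition winv (w : word) : word := rev [seq (a.1, ~~ a.2) | a <- w].

Variable rels : word -> word -> Prop.

(* The least congruence on words that makes (i, b) and (i, ~~ b) cancel and
   contains rels. *)
Inductive pres_eq : word -> word -> Prop :=
| pres_refl u : pres_eq u u
| pres_sym u v : pres_eq u v -> pres_eq v u
| pres_trans u v w : pres_eq u v -> pres_eq v w -> pres_eq u w
| pres_cat u1 u2 v1 v2 :
    pres_eq u1 v1 -> pres_eq u2 v2 -> pres_eq (u1 ++ u2) (v1 ++ v2)
| pres_cancel i b : pres_eq [:: (i, b); (i, ~~ b)] [::]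
| pres_rel u v : rels u v -> pres_eq u v.

Definition pres_eqb : rel word := fun u v => `[< pres_eq u v >].

Lemma pres_eqb_equiv : equiv_class_of pres_eqb.
Proof.
split=> [u|u v|v u w].
- exact/asboolP/pres_refl.
- by apply/idP/idP => /asboolP uv; apply/asboolP/pres_sym.
- by move=> /asboolP uv /asboolP vw; apply/asboolP/(pres_trans uv).
Qed.

Canonical pres_equiv := EquivRelPack pres_eqb_equiv.

Definition pres_group := {eq_quot pres_equiv}%qT.

HB.instance Definition _ := Choice.on pres_group.
HB.instance Definition _ := EqQuotient.on pres_group.

Local Open Scope quotient_scope.

Lemma pres_eqP (u v : word) :
  \pi_pres_group u = \pi_pres_group v <-> pres_eq u v.
Proof.
split=> [/eqP|uv]; first by rewrite eqmodE => /asboolP.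
by apply/eqP; rewrite eqmodE; apply/asboolP.
Qed.

Lemma pres_W (P : pres_group -> Prop) :
  (forall u, P (\pi_pres_group u)) -> forall x, P x.
Proof. by move=> Ppi x; rewrite -[x]reprK. Qed.

Lemma pres_reprK (u : word) : pres_eq (repr (\pi_pres_group u)) u.
Proof. by apply/pres_eqP; rewrite reprK. Qed.

Lemma pres_winv (u v : word) : pres_eq u v -> pres_eq (winv u) (winv v).
Proof.
have winv_cat a b : winv (a ++ b) = winv b ++ winv a.
  by rewrite /winv map_cat rev_cat.
have winvl w : pres_eq (winv w ++ w) [::].
  elim: w => [|[i b] w IH]; first exact: pres_refl.
  rewrite -[_ :: w]cat1s winv_cat -catA.
  apply: (pres_trans _ IH); apply: pres_cat; first exact: pres_refl.
  rewrite catA -[X in pres_eq _ X]cat0s; apply: pres_cat (pres_refl _).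
  by rewrite /winv /rev /= -{2}[b]negbK; apply: pres_cancel.
have winvr w : pres_eq (w ++ winv w) [::].
  elim/last_ind: w => [|w [i b] IH]; first exact: pres_refl.
  rewrite -cats1 winv_cat -catA.
  apply: (pres_trans _ IH); apply: pres_cat; first exact: pres_refl.
  rewrite catA -[X in pres_eq _ X]cat0s; apply: pres_cat (pres_refl _).
  exact: pres_cancel.
move=> uv; rewrite -[winv v]cat0s -[winv u]cats0.
apply: (@pres_trans _ (winv u ++ (v ++ winv v))).
  by apply: pres_cat (pres_refl _) _; apply/pres_sym/winvr.
rewrite catA; apply: pres_cat (pres_refl _).
apply: pres_trans (winvl u); apply: pres_cat (pres_refl _) (pres_sym uv).
Qed.

Definition pres_one : pres_group := \pi_pres_group [::].
Definition pres_mul (x y : pres_group) : pres_group := \pi_pres_group (repr x ++ repr y).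
Definition pres_inv (x : pres_group) : pres_group := \pi_pres_group (winv (repr x)).

Lemma pres_mul_pi (u v : word) :
  pres_mul (\pi_pres_group u) (\pi_pres_group v) = \pi_pres_group (u ++ v).
Proof. by apply/pres_eqP/pres_cat; apply: pres_reprK. Qed.

Lemma pres_inv_pi (u : word) : pres_inv (\pi_pres_group u) = \pi_pres_group (winv u).
Proof. exact/pres_eqP/pres_winv/pres_reprK. Qed.

Lemma pres_mulA : associative pres_mul.
Proof.
move=> x y z; elim/pres_W: x => u; elim/pres_W: y => v; elim/pres_W: z => w.
by rewrite !pres_mul_pi catA.
Qed.

Lemma pres_mul1g : left_id pres_one pres_mul.
Proof. by move=> x; elim/pres_W: x => u; rewrite pres_mul_pi. Qed.

Lemma pres_mulg1 : right_id pres_one pres_mul.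
Proof. by move=> x; elim/pres_W: x => u; rewrite pres_mul_pi cats0. Qed.

Lemma pres_mulgV : right_inverse pres_one pres_inv pres_mul.
Proof.
move=> x; elim/pres_W: x => u; rewrite pres_inv_pi pres_mul_pi; apply/pres_eqP.
elim/last_ind: u => [|u [i b] IH]; first exact: pres_refl.
rewrite /winv map_rcons rev_rcons cat_rcons.
apply: (pres_trans _ IH); apply: pres_cat (pres_refl _) _.
rewrite -[X in pres_eq _ X]cat0s -[_ :: _]/([:: _; _] ++ _).
exact: pres_cat (pres_cancel i b) (pres_refl _).
Qed.

Lemma pres_mulVg : left_inverse pres_one pres_inv pres_mul.
Proof.
move=> x; rewrite -[RHS](pres_mulgV (pres_inv x)); congr (pres_mul _ _).
elim/pres_W: x => u; rewrite !pres_inv_pi; congr (\pi_pres_group _).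
rewrite /winv map_rev revK -map_comp -[LHS]map_id.
by apply: eq_map => -[i b] /=; rewrite negbK.
Qed.

HB.instance Definition _ := isGroup.Build pres_group
  pres_mulA pres_mul1g pres_mulg1 pres_mulVg pres_mulgV.

Definition pres_gen (i : I) : pres_group := \pi_pres_group [:: (i, false)].
End PresentedGroup.

Section TwistSpunTrefoil.
Variable m : nat.
Local Open Scope quotient_scope.
Local Open Scope group_scope.

(* The generators gamma_1, ..., gamma_m are indexed by 'I_m = {0, ..., m-1};
   ordS and ord_pred are the successor and the predecessor modulo m. *)
Definition trefoil_rel (u v : word 'I_m) : Prop :=
  exists i : 'I_m,
    u = [:: (i, false)] /\ v = [:: (ordS i, false); (ord_pred i, false)].

Definition fiber_group := pres_group trefoil_rel.
HB.instance Definition _ := monoid.Group.on fiber_group.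
HB.instance Definition _ := EqQuotient.on fiber_group.

Lemma fiber_W (P : fiber_group -> Prop) :
  (forall u, P (\pi_fiber_group u)) -> forall x, P x.
Proof. exact: pres_W. Qed.

Definition fiber_gen (i : 'I_m) : fiber_group := pres_gen trefoil_rel i.

Lemma fiber_gen_rel (i : 'I_m) :
  fiber_gen i = fiber_gen (ordS i) * fiber_gen (ord_pred i).
Proof.
by rewrite [RHS]pres_mul_pi; apply/pres_eqP/pres_rel; exists i.
Qed.

Definition shift_word (w : word 'I_m) : word 'I_m :=
  [seq (ordS a.1, a.2) | a <- w].

Definition monodromy (x : fiber_group) : fiber_group :=
  \pi_fiber_group (shift_word (repr x)).

Lemma pres_eq_shift (u v : word 'I_m) : pres_eq trefoil_rel u v ->
  pres_eq trefoil_rel (shift_word u) (shift_word v).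
Proof.
elim=> {u v} [u|u v _|u v w _ uv _|u1 u2 v1 v2 _ e1 _ e2|i b|u v [i [-> ->]]].
- exact: pres_refl.
- exact: pres_sym.
- exact: pres_trans.
- by rewrite /shift_word !map_cat; apply: pres_cat.
- exact: pres_cancel.
by apply: pres_rel; exists (ordS i); rewrite /= ordSK ord_predK.
Qed.

Lemma monodromy_pi (u : word 'I_m) :
  monodromy (\pi_fiber_group u) = \pi_fiber_group (shift_word u).
Proof. exact/pres_eqP/pres_eq_shift/pres_reprK. Qed.

Lemma monodromy_gen (i : 'I_m) : monodromy (fiber_gen i) = fiber_gen (ordS i).
Proof. exact: monodromy_pi. Qed.

Lemma monodromyM : {morph monodromy : x y / x * y}.
Proof.
move=> x y; elim/fiber_W: x => u; elim/fiber_W: y => v.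
by rewrite [_ * _]pres_mul_pi !monodromy_pi [RHS]pres_mul_pi /shift_word map_cat.
Qed.

Lemma monodromy_bij : bijective monodromy.
Proof.
have E k u : iter k monodromy (\pi_fiber_group u) =
    \pi_fiber_group [seq (iter k (@ordS m) a.1, a.2) | a <- u].
  elim: k => [|k IH]; first by congr (\pi_fiber_group _); rewrite -[LHS]map_id; apply: eq_map; case.
  by rewrite iterS IH monodromy_pi /shift_word -map_comp.
have I k i : iter k (@ordS m) i = (i + k)%N %% m :> nat.
  elim: k => [|k /= ->]; first by rewrite addn0 modn_small.
  by rewrite -addn1 modnDml addn1 addnS.
have iterm x : iter m monodromy x = x.
  elim/fiber_W: x => u; rewrite E; congr (\pi_fiber_group _).
  rewrite -[RHS]map_id; apply: eq_map => -[i b] /=; congr (_, _); apply: val_inj.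
  by rewrite /= I modnDr modn_small.
case: (posnP m) => [m0|m_gt0]; last first.
  by exists (iter m.-1 monodromy) => x; rewrite -?iterSr -?iterS prednK ?iterm.
suff mono_id x : monodromy x = x by exists id => x; rewrite mono_id.
elim/fiber_W: x => -[|[i b] u]; first exact: monodromy_pi.
by case: i => i lt_im; exfalso; rewrite m0 in lt_im.
Qed.

Lemma monodromy1 : monodromy 1 = 1.
Proof. exact: monodromy_pi. Qed.

Lemma monodromyV x : monodromy x^-1 = (monodromy x)^-1.
Proof.
by apply: (mulgI (monodromy x)); rewrite -monodromyM !mulgV monodromy1.
Qed.

Definition trefoil_op (x y : fiber_group) : fiber_group :=
  monodromy (x * y^-1) * y.

Lemma trefoil_opxx x : trefoil_op x x = x.
Proof. by rewrite /trefoil_op mulgV monodromy1 mul1g. Qed.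

Lemma trefoil_op_bij x : bijective (fun w => trefoil_op w x).
Proof.
have [f mfK fmK] := monodromy_bij.
exists (fun w => f (w * x^-1) * x) => w; rewrite /trefoil_op.
  by rewrite mulgK mfK mulgVK.
by rewrite mulgK fmK mulgVK.
Qed.

Lemma trefoil_op_dist x y z : trefoil_op (trefoil_op x y) z =
  trefoil_op (trefoil_op x z) (trefoil_op y z).
Proof.
rewrite /trefoil_op; set b := monodromy (y * z^-1).
have -> : monodromy (x * z^-1) * z * (b * z)^-1 = monodromy (x * y^-1).
  rewrite invgM mulgA mulgK -monodromyV -monodromyM invgM invgK.
  by rewrite mulgA mulgVK.
set c := monodromy (x * y^-1).
by rewrite -[c * y * _]mulgA monodromyM -mulgA.
Qed.

Definition trefoil_quandle : quandle :=
  Quandle (inhabits 1) trefoil_opxx trefoil_op_bij trefoil_op_dist.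
End TwistSpunTrefoil.

Section CellQuandle.
Variables (R : realType) (V : set 'cV[R]_4) (Rm : 'cV[R]_4 -> 'M[R]_4).
Local Open Scope ring_scope.
Local Open Scope classical_set_scope.

Definition cell_map (v : 'cV[R]_4) : 'cV[R]_4 -> 'cV[R]_4 :=
  fun x => Rm v *m x.

Record cell_axioms : Prop := CellAxioms {
  cell_nonempty : V !=set0;
  cell_unit : forall v, V v -> Rm v \in unitmx;
  cell_fix : forall v, V v -> cell_map v v = v;
  cell_image : forall v, V v -> cell_map v @` V = V;
  cell_conj : forall v w, V v -> V w ->
    Rm (cell_map w v) = Rm w *m Rm v *m invmx (Rm w) }.

Hypothesis VR : cell_axioms.

Definition cell_set : set ('cV[R]_4 * ('cV[R]_4 -> 'cV[R]_4)) :=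
  [set (v, cell_map v) | v in V].

Lemma cell_setP (x : cell_set) :
  V (val x).1 /\ val x = ((val x).1, cell_map (val x).1).
Proof. by case: x => p /= /set_mem[v Vv <-]. Qed.

Lemma cell_op_subproof (x y : cell_set) :
  (cell_map (val y).1 (val x).1, cell_map (cell_map (val y).1 (val x).1))
    \in cell_set.
Proof.
apply/mem_set; exists (cell_map (val y).1 (val x).1) => //.
rewrite -[X in X _](cell_image VR (cell_setP y).1).
by exists (val x).1; first exact: (cell_setP x).1.
Qed.

Definition cell_op (x y : cell_set) : cell_set :=
  SigSub (cell_op_subproof x y).

Lemma cell_val_inj (x y : cell_set) : (val x).1 = (val y).1 -> x = y.
Proof.
move=> exy; apply: val_inj.
by rewrite (cell_setP x).2 (cell_setP y).2 exy.
Qed.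

Lemma cell_inhabited : inhabited cell_set.
Proof.
have [v Vv] := cell_nonempty VR.
have vX : (v, cell_map v) \in cell_set by apply/mem_set; exists v.
exact: inhabits (SigSub vX).
Qed.

Lemma cell_opxx x : cell_op x x = x.
Proof. exact/cell_val_inj/(cell_fix VR (cell_setP x).1). Qed.

Lemma cell_op_bij x : bijective (fun w => cell_op w x).
Proof.
have Vx := (cell_setP x).1; have Ux := cell_unit VR Vx.
have img (w : cell_set) : exists u : cell_set, cell_op u x = w.
  have := (cell_setP w).1; rewrite -[X in X _](cell_image VR Vx) => -[u Vu e].
  have uX : (u, cell_map u) \in cell_set by apply/mem_set; exists u.
  by exists (SigSub uX); apply: cell_val_inj.
pose g w := projT1 (cid (img w)).
have gK : cancel g (fun w => cell_op w x) by move=> w; apply: projT2 (cid (img w)).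
exists g => // w; apply: cell_val_inj.
have := congr1 (fun u => (val u).1) (gK (cell_op w x)).
by rewrite /= /cell_map => /(congr1 (mulmx (invmx (Rm (val x).1)))); rewrite !mulKmx.
Qed.

Lemma cell_op_dist x y z :
  cell_op (cell_op x y) z = cell_op (cell_op x z) (cell_op y z).
Proof.
have [Vy Vz] := ((cell_setP y).1, (cell_setP z).1).
apply: cell_val_inj => /=; rewrite [in RHS]/cell_map (cell_conj VR Vy Vz).
by rewrite /cell_map -!mulmxA mulKmx ?(cell_unit VR).
Qed.

Definition cell_quandle : quandle :=
  Quandle cell_inhabited cell_opxx cell_op_bij cell_op_dist.
End CellQuandle.

Section CellData.
Variable R : realType.
Local Open Scope ring_scope.
Local Open Scope classical_set_scope.

Definition golden : R := (1 + Num.sqrt 5) / 2.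
Local Notation phi := golden.

(* Coordinates are indexed from 0: basis_vec 0, ..., basis_vec 3 are the
   vectors e_1, ..., e_4. *)
Definition basis_vec (i : 'I_4) : 'cV[R]_4 := delta_mx i 0.
Local Notation e := basis_vec.

Definition vec4 (a b c d : R) : 'cV[R]_4 := \col_i [:: a; b; c; d]`_i.

Definition mx4 (rows : seq (seq R)) : 'M[R]_4 :=
  \matrix_(i, j) (nth [::] rows i)`_j.

Definition vertices16 : set 'cV[R]_4 :=
  [set v | exists (i : 'I_4) (s : bool), v = (-1) ^+ s *: e i].

Definition vertices24 : set 'cV[R]_4 :=
  [set v | exists (i j : 'I_4) (s t : bool),
     (i < j)%N /\ v = (-1) ^+ s *: e i + (-1) ^+ t *: e j].

Definition vertices600 : set 'cV[R]_4 :=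
  vertices16
  `|` [set v | exists s t u w : bool,
         v = 2^-1 *: ((-1) ^+ s *: e 0 + (-1) ^+ t *: e 1
                      + (-1) ^+ u *: e 2 + (-1) ^+ w *: e 3)]
  `|` [set v | exists (sigma : 'S_4) (s t u : bool), sigma \in Alt 'I_4 /\
         v = 2^-1 *: (((-1) ^+ s * phi) *: e (sigma 0)
                      + (-1) ^+ t *: e (sigma 1)
                      + ((-1) ^+ u * phi^-1) *: e (sigma 2))].

(* An entry (l, M) of a table assigns the matrix M to the vectors v and - v
   for v in l; rotation T v is the identity when v is not listed. *)
Definition rotation_table := seq (seq 'cV[R]_4 * 'M[R]_4).

Definition rotation (T : rotation_table) (v : 'cV[R]_4) : 'M[R]_4 :=
  if [seq p <- T | (v \in p.1) || (- v \in p.1)] is p :: _ then p.2 else 1%:M.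

Definition table16 : rotation_table := [::
  ([:: vec4 1 0 0 0],
      mx4 [:: [:: 1; 0; 0; 0];
              [:: 0; 0; 0; 1];
              [:: 0; 1; 0; 0];
              [:: 0; 0; 1; 0]]);
  ([:: vec4 0 1 0 0],
      mx4 [:: [:: 0; 0; - 1; 0];
              [:: 0; 1; 0; 0];
              [:: 0; 0; 0; - 1];
              [:: 1; 0; 0; 0]]);
  ([:: vec4 0 0 1 0],
      mx4 [:: [:: 0; 0; 0; - 1];
              [:: 1; 0; 0; 0];
              [:: 0; 0; 1; 0];
              [:: 0; - 1; 0; 0]]);
  ([:: vec4 0 0 0 1],
      mx4 [:: [:: 0; - 1; 0; 0];
              [:: 0; 0; - 1; 0];
              [:: 1; 0; 0; 0];
              [:: 0; 0; 0; 1]])].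

Definition table24 : rotation_table := [::
  ([:: vec4 1 1 0 0;
       vec4 1 (- 1) 0 0],
      mx4 [:: [:: 1; 0; 0; 0];
              [:: 0; 1; 0; 0];
              [:: 0; 0; 0; - 1];
              [:: 0; 0; 1; 0]]);
  ([:: vec4 0 0 1 1;
       vec4 0 0 1 (- 1)],
      mx4 [:: [:: 0; - 1; 0; 0];
              [:: 1; 0; 0; 0];
              [:: 0; 0; 1; 0];
              [:: 0; 0; 0; 1]]);
  ([:: vec4 1 0 1 0;
       vec4 0 1 0 1],
      2^-1 *: mx4 [:: [:: 1; - 1; 1; 1];
                      [:: 1; 1; - 1; 1];
                      [:: 1; 1; 1; - 1];
                      [:: - 1; 1; 1; 1]]);
  ([:: vec4 1 0 (- 1) 0;
       vec4 0 1 0 (- 1)],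
      2^-1 *: mx4 [:: [:: 1; - 1; - 1; - 1];
                      [:: 1; 1; 1; - 1];
                      [:: - 1; - 1; 1; - 1];
                      [:: 1; - 1; 1; 1]]);
  ([:: vec4 1 0 0 1;
       vec4 0 1 (- 1) 0],
      2^-1 *: mx4 [:: [:: 1; - 1; - 1; 1];
                      [:: 1; 1; - 1; - 1];
                      [:: 1; - 1; 1; - 1];
                      [:: 1; 1; 1; 1]]);
  ([:: vec4 0 1 1 0;
       vec4 1 0 0 (- 1)],
      2^-1 *: mx4 [:: [:: 1; - 1; 1; - 1];
                      [:: 1; 1; 1; 1];
                      [:: - 1; 1; 1; - 1];
                      [:: - 1; - 1; 1; 1]])].

Definition table600 : rotation_table := [::
  ([:: vec4 1 0 0 0;
       2^-1 *: vec4 phi 1 (phi^-1) 0;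
       2^-1 *: vec4 phi (- 1) (- phi^-1) 0;
       2^-1 *: vec4 (phi^-1) phi 1 0;
       2^-1 *: vec4 (phi^-1) (- phi) (- 1) 0],
      2^-1 *: mx4 [:: [:: 2; 0; 0; 0];
                      [:: 0; 1; phi; - phi^-1];
                      [:: 0; phi; - phi^-1; 1];
                      [:: 0; phi^-1; - 1; - phi]]);
  ([:: vec4 0 1 0 0;
       2^-1 *: vec4 1 phi 0 (phi^-1);
       2^-1 *: vec4 1 (- phi) 0 (phi^-1);
       2^-1 *: vec4 phi (phi^-1) 0 1;
       2^-1 *: vec4 phi (- phi^-1) 0 1],
      2^-1 *: mx4 [:: [:: 1; 0; phi^-1; phi];
                      [:: 0; 2; 0; 0];
                      [:: - phi^-1; 0; - phi; 1];
                      [:: phi; 0; - 1; - phi^-1]]);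
  ([:: vec4 0 0 1 0;
       2^-1 *: vec4 1 0 (phi^-1) (- phi);
       2^-1 *: vec4 1 0 (- phi^-1) (- phi);
       2^-1 *: vec4 (phi^-1) 0 phi (- 1);
       2^-1 *: vec4 (phi^-1) 0 (- phi) (- 1)],
      2^-1 *: mx4 [:: [:: - phi^-1; 1; 0; - phi];
                      [:: - 1; - phi; 0; - phi^-1];
                      [:: 0; 0; 2; 0];
                      [:: - phi; phi^-1; 0; 1]]);
  ([:: vec4 0 0 0 1;
       2^-1 *: vec4 0 1 (- phi) (phi^-1);
       2^-1 *: vec4 0 1 (- phi) (- phi^-1);
       2^-1 *: vec4 0 (phi^-1) (- 1) phi;
       2^-1 *: vec4 0 (phi^-1) (- 1) (- phi)],
      2^-1 *: mx4 [:: [:: - phi; 1; phi^-1; 0];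
                      [:: - 1; - phi^-1; - phi; 0];
                      [:: - phi^-1; - phi; 1; 0];
                      [:: 0; 0; 0; 2]]);
  ([:: 2^-1 *: vec4 1 1 (- 1) 1;
       2^-1 *: vec4 1 0 (- phi^-1) phi;
       2^-1 *: vec4 0 phi (- phi^-1) (- 1);
       2^-1 *: vec4 (phi^-1) phi (- 1) 0;
       2^-1 *: vec4 (phi^-1) (- 1) 0 phi],
      2^-1 *: mx4 [:: [:: - phi^-1; 1; 0; phi];
                      [:: 0; 1; - phi; - phi^-1];
                      [:: - phi; - 1; - phi^-1; 0];
                      [:: 1; - 1; - 1; 1]]);
  ([:: 2^-1 *: vec4 1 (- 1) (- 1) (- 1);
       2^-1 *: vec4 1 (phi^-1) phi 0;
       2^-1 *: vec4 phi (- phi^-1) 0 (- 1);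
       2^-1 *: vec4 0 1 phi (phi^-1);
       2^-1 *: vec4 phi 0 1 (- phi^-1)],
      2^-1 *: mx4 [:: [:: 1; 0; phi^-1; - phi];
                      [:: - 1; - phi^-1; phi; 0];
                      [:: 1; 1; 1; 1];
                      [:: - 1; phi; 0; - phi^-1]]);
  ([:: 2^-1 *: vec4 1 (- 1) 1 (- 1);
       2^-1 *: vec4 1 (- phi^-1) phi 0;
       2^-1 *: vec4 0 (phi^-1) 1 phi;
       2^-1 *: vec4 (phi^-1) 0 phi 1;
       2^-1 *: vec4 (phi^-1) (- 1) 0 (- phi)],
      2^-1 *: mx4 [:: [:: - phi^-1; 0; phi; - 1];
                      [:: - phi; - phi^-1; 0; 1];
                      [:: 1; - 1; 1; 1];
                      [:: 0; phi; phi^-1; 1]]);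
  ([:: 2^-1 *: vec4 1 (- 1) (- 1) 1;
       2^-1 *: vec4 1 phi 0 (- phi^-1);
       2^-1 *: vec4 phi 0 (- 1) (phi^-1);
       2^-1 *: vec4 phi 1 (- phi^-1) 0;
       2^-1 *: vec4 0 phi (phi^-1) (- 1)],
      2^-1 *: mx4 [:: [:: 1; 1; - 1; 1];
                      [:: phi^-1; 1; 0; - phi];
                      [:: - phi; 1; - phi^-1; 0];
                      [:: 0; - 1; - phi; - phi^-1]]);
  ([:: 2^-1 *: vec4 1 1 (- 1) (- 1);
       2^-1 *: vec4 1 (phi^-1) (- phi) 0;
       2^-1 *: vec4 0 (phi^-1) 1 (- phi);
       2^-1 *: vec4 (phi^-1) 1 0 (- phi);
       2^-1 *: vec4 (phi^-1) 0 (- phi) 1],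
      2^-1 *: mx4 [:: [:: - phi^-1; phi; - 1; 0];
                      [:: 0; - phi^-1; - 1; - phi];
                      [:: - phi; 0; 1; - phi^-1];
                      [:: - 1; - 1; - 1; 1]]);
  ([:: 2^-1 *: vec4 1 1 1 1;
       2^-1 *: vec4 1 (- phi) 0 (- phi^-1);
       2^-1 *: vec4 phi 0 1 (phi^-1);
       2^-1 *: vec4 0 phi (phi^-1) 1;
       2^-1 *: vec4 phi (- 1) (phi^-1) 0],
      2^-1 *: mx4 [:: [:: 1; - phi^-1; phi; 0];
                      [:: - 1; 1; 1; 1];
                      [:: 1; 0; - phi^-1; phi];
                      [:: 1; phi; 0; - phi^-1]]);
  ([:: 2^-1 *: vec4 1 (- 1) 1 1;
       2^-1 *: vec4 1 0 (phi^-1) phi;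
       2^-1 *: vec4 0 phi (- phi^-1) 1;
       2^-1 *: vec4 (phi^-1) 1 0 phi;
       2^-1 *: vec4 (phi^-1) (- phi) 1 0],
      2^-1 *: mx4 [:: [:: - phi^-1; 0; phi; 1];
                      [:: - 1; 1; - 1; 1];
                      [:: 0; - phi; - phi^-1; 1];
                      [:: phi; phi^-1; 0; 1]]);
  ([:: 2^-1 *: vec4 1 1 1 (- 1);
       2^-1 *: vec4 1 (- phi^-1) (- phi) 0;
       2^-1 *: vec4 phi (phi^-1) 0 (- 1);
       2^-1 *: vec4 0 1 phi (- phi^-1);
       2^-1 *: vec4 phi 0 (- 1) (- phi^-1)],
      2^-1 *: mx4 [:: [:: 1; 1; - 1; - 1];
                      [:: 0; - phi^-1; 1; - phi];
                      [:: - phi^-1; phi; 1; 0];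
                      [:: - phi; 0; - 1; - phi^-1]])].

(* A pair (a, b) encodes a + b * phi; a list of four pairs encodes half of the
   corresponding vector, a list of four such lists half of the corresponding
   matrix. *)
Definition code : Type := int * int.
Definition cvec : Type := seq code.
Definition cmat : Type := seq cvec.

Definition ev (c : code) : R := c.1%:~R + c.2%:~R * phi.
Definition cget (v : cvec) (i : nat) : code := nth (0, 0) v i.
Definition evv (v : cvec) : 'cV[R]_4 := 2^-1 *: \col_i ev (cget v i).
Definition cgetm (M : cmat) (i j : nat) : code := cget (nth [::] M i) j.
Definition evm (M : cmat) : 'M[R]_4 := 2^-1 *: \matrix_(i, j) ev (cgetm M i j).

Definition cadd (x y : code) : code := (x.1 + y.1, x.2 + y.2).
Definition cneg (x : code) : code := (- x.1, - x.2).
Definition cmul (x y : code) : code :=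
  (x.1 * y.1 + x.2 * y.2, x.1 * y.2 + x.2 * y.1 + x.2 * y.2).
Definition csum4 (f : nat -> code) : code :=
  cadd (cadd (f 0%N) (f 1%N)) (cadd (f 2%N) (f 3%N)).
Definition csgn (s : bool) (x : code) : code := if s then cneg x else x.

Definition mkv (f : nat -> code) : cvec := mkseq f 4.
Definition mkm (f : nat -> nat -> code) : cmat :=
  mkseq (fun i => mkv (f i)) 4.
Definition cnorm (v : cvec) : cvec := mkv (cget v).
Definition cvneg (v : cvec) : cvec := mkv (fun i => cneg (cget v i)).
Definition cvadd (u v : cvec) : cvec := mkv (fun i => cadd (cget u i) (cget v i)).
Definition cdbl (v : cvec) : cvec := cvadd v v.
Definition cunit (i : nat) (x : code) : cvec :=
  mkv (fun j => if j == i then x else (0, 0)).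
Definition cmv (M : cmat) (v : cvec) : cvec :=
  mkv (fun i => csum4 (fun j => cmul (cgetm M i j) (cget v j))).
Definition cmm (M N : cmat) : cmat :=
  mkm (fun i k => csum4 (fun j => cmul (cgetm M i j) (cgetm N j k))).
Definition ctr (M : cmat) : cmat := mkm (fun i j => cgetm M j i).

Lemma sqrt5_sqr : Num.sqrt 5 ^+ 2 = 5 :> R.
Proof. by rewrite sqr_sqrtr. Qed.

Lemma golden_sqr : phi ^+ 2 = phi + 1.
Proof. by rewrite /golden; have := sqrt5_sqr; lra. Qed.

Lemma golden_neq0 : phi != 0.
Proof.
apply/eqP => phi0; have := golden_sqr.
by rewrite phi0 expr0n add0r => /esym/eqP; rewrite oner_eq0.
Qed.

Lemma ev_add x y : ev (cadd x y) = ev x + ev y.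
Proof. by rewrite /ev /= !intrD; ring. Qed.

Lemma ev_neg x : ev (cneg x) = - ev x.
Proof. by rewrite /ev /= !intrN; ring. Qed.

Lemma ev_mul x y : ev (cmul x y) = ev x * ev y.
Proof.
rewrite /ev /= !intrD !intrM; have := golden_sqr; rewrite expr2 => phi2.
transitivity (x.1%:~R * y.1%:~R + (x.1%:~R * y.2%:~R + x.2%:~R * y.1%:~R) * phi
  + x.2%:~R * y.2%:~R * (phi * phi) : R); first by rewrite phi2; ring.
by ring.
Qed.

Lemma ev_sgn s x : ev (csgn s x) = (-1) ^+ s * ev x.
Proof. by case: s; rewrite /= ?ev_neg ?expr1 ?expr0 ?mulN1r ?mul1r. Qed.

Lemma ev_0 : 0 = ev (0, 0). Proof. by rewrite /ev mul0r addr0. Qed.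
Lemma ev_1 : 1 = ev (1, 0). Proof. by rewrite /ev mul0r addr0. Qed.
Lemma ev_N1 : - 1 = ev (-1, 0). Proof. by rewrite /ev mul0r addr0. Qed.
Lemma ev_2 : 2 = ev (2, 0). Proof. by rewrite /ev mul0r addr0. Qed.
Lemma ev_phi : phi = ev (0, 1). Proof. by rewrite /ev mul1r add0r. Qed.
Lemma ev_Nphi : - phi = ev (0, -1). Proof. by rewrite /ev /= mulN1r add0r. Qed.

Lemma ev_phiV : phi^-1 = ev (-1, 1).
Proof.
apply: (mulfI golden_neq0); rewrite mulfV ?golden_neq0 //.
by rewrite /ev /= mul1r mulrDr -expr2 golden_sqr; ring.
Qed.

Lemma ev_NphiV : - phi^-1 = ev (1, -1).
Proof. by rewrite ev_phiV -ev_neg. Qed.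

Lemma ev_inj : injective ev.
Proof.
suff ev0 x : ev x = 0 -> x = (0, 0).
  move=> x y exy; have := ev0 (cadd x (cneg y)).
  rewrite ev_add ev_neg exy subrr => /(_ erefl)[].
  by case: x y {exy} => [a b] [c d] /= /subr0_eq -> /subr0_eq ->.
case: x => a b; rewrite /ev /= => ab0.
have sq : (2 * a + b) ^+ 2 = 5 * b ^+ 2 :> int.
  apply/eqP; rewrite -(eqr_int R) !(intrM, intrD, rmorphXn) /=; apply/eqP.
  have -> : 2%:~R * a%:~R + b%:~R = - (b%:~R * Num.sqrt 5) :> R.
    by move: ab0; rewrite /golden; lra.
  by rewrite -expr2 sqrrN exprMn sqrt5_sqr; ring.
have b0 : b = 0.
  apply/eqP; case: eqVneq => // b_neq0.
  have := congr1 (fun z => logn 5 `|z|%N) sq.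
  rewrite /= abszM !abszX lognM ?expn_gt0 ?absz_gt0 ?b_neq0 // !lognX.
  by move=> /(congr1 odd); rewrite oddD !oddM.
rewrite b0; move: ab0; rewrite b0 mul0r addr0 => /eqP; rewrite intr_eq0.
by move=> /eqP ->.
Qed.

Lemma cget_mkv f i : (i < 4)%N -> cget (mkv f) i = f i.
Proof. exact: nth_mkseq. Qed.

Lemma cgetm_mkm f i j : (i < 4)%N -> (j < 4)%N -> cgetm (mkm f) i j = f i j.
Proof. by move=> i4 j4; rewrite /cgetm nth_mkseq // cget_mkv. Qed.

Lemma evvE v i j : evv v i j = 2^-1 * ev (cget v i).
Proof. by rewrite !mxE. Qed.

Lemma evmE M i j : evm M i j = 2^-1 * ev (cgetm M i j).
Proof. by rewrite !mxE. Qed.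

Lemma half_neq0 : 2^-1 != 0 :> R. Proof. by rewrite invr_eq0 pnatr_eq0. Qed.

Lemma evv_norm v : evv (cnorm v) = evv v.
Proof. by apply/colP => i; rewrite !evvE cget_mkv. Qed.

Lemma evv_eq u v : (evv u == evv v) = (cnorm u == cnorm v).
Proof.
apply/eqP/eqP => [uv|uv]; last by rewrite -evv_norm uv evv_norm.
apply: (@eq_from_nth _ (0, 0)); rewrite !size_mkseq // => i i4.
rewrite !nth_mkseq //.
have /colP/(_ (Ordinal i4)) := uv; rewrite !evvE /= => /(mulfI half_neq0).
exact: ev_inj.
Qed.

Lemma evv_neg v : evv (cvneg v) = - evv v.
Proof. by apply/colP => i; rewrite [RHS]mxE !evvE cget_mkv // ev_neg mulrN. Qed.

Lemma evv_add u v : evv (cvadd u v) = evv u + evv v.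
Proof. by apply/colP => i; rewrite [RHS]mxE !evvE cget_mkv // ev_add mulrDr. Qed.

Lemma evv_unit (i : 'I_4) x : evv (cunit i x) = (2^-1 * ev x) *: e i.
Proof.
apply/colP => j; rewrite evvE cget_mkv // !mxE eqxx andbT val_eqE.
by case: eqP => _; rewrite ?mulr1 // -ev_0 !mulr0.
Qed.

Lemma ev_sum4 (f : nat -> code) : ev (csum4 f) = \sum_(i < 4) ev (f i).
Proof.
by rewrite !big_ord_recl big_ord0 /csum4 !ev_add addr0 !addrA.
Qed.

Lemma evv_mul M v : evm M *m evv v = 2^-1 *: evv (cmv M v).
Proof.
apply/colP => i; rewrite [RHS]mxE evvE cget_mkv // ev_sum4 !mxE !mulr_sumr.
by apply: eq_bigr => j _; rewrite evvE evmE ev_mul; ring.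
Qed.

Lemma evm_mul M N : evm M *m evm N = 2^-1 *: evm (cmm M N).
Proof.
apply/matrixP => i k; rewrite [RHS]mxE evmE cgetm_mkm // ev_sum4 !mxE !mulr_sumr.
by apply: eq_bigr => j _; rewrite !evmE ev_mul; ring.
Qed.

Lemma evm_tr M : (evm M)^T = evm (ctr M).
Proof. by apply/matrixP => i j; rewrite mxE !evmE cgetm_mkm. Qed.

Lemma evv_mulP M u v :
  (evm M *m evv u == evv v) = (cmv M u == cdbl v).
Proof.
have -> : (cmv M u == cdbl v) = (cnorm (cmv M u) == cnorm (cdbl v)) by [].
rewrite -evv_eq evv_mul evv_add -mulr2n -scaler_nat.
have two_neq0 : 2 != 0 :> R by rewrite pnatr_eq0.
by apply/eqP/eqP => [<-|->]; rewrite scalerA ?mulfV ?mulVf // scale1r.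
Qed.

Definition citem : Type := seq cvec * cmat.
Definition evi (p : citem) : seq 'cV[R]_4 * 'M[R]_4 :=
  ([seq evv u | u <- p.1], evm p.2).

Definition mem_pm (v : 'cV[R]_4) (l : seq 'cV[R]_4) := (v \in l) || (- v \in l).
Definition cmem_pm (c : cvec) (l : seq cvec) :=
  has (fun u => (cnorm c == cnorm u) || (cvneg c == cnorm u)) l.

Lemma mem_pm_ev c l : mem_pm (evv c) [seq evv u | u <- l] = cmem_pm c l.
Proof.
have mem_ev b : (evv b \in [seq evv u | u <- l]) =
    has (fun u => cnorm b == cnorm u) l.
  by rewrite -has_pred1 has_map; apply: eq_has => u /=; rewrite eq_sym evv_eq.
by rewrite /mem_pm -evv_neg !mem_ev -has_predU; apply: eq_has.
Qed.

Lemma mem_pmP v l : reflect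
  (exists2 u, u \in l & exists s : bool, v = (-1) ^+ s *: evv u)
  (mem_pm v [seq evv u | u <- l]).
Proof.
apply: (iffP orP) => [[] /mapP[u lu e]|[u lu [[] ->]]].
- by exists u => //; exists false; rewrite scale1r.
- by exists u => //; exists true; rewrite expr1 scaleN1r -e opprK.
- by right; rewrite expr1 scaleN1r opprK map_f.
- by left; rewrite expr0 scale1r map_f.
Qed.

Definition csol (M : cmat) (v : cvec) (l : seq cvec) :=
  let w := cmv M v in
  has (fun u => (w == cdbl u) || (w == cdbl (cvneg u))) l.

Lemma csolP M v l (s : bool) : csol M v l ->
  mem_pm (evm M *m ((-1) ^+ s *: evv v)) [seq evv u | u <- l].
Proof.
rewrite /csol => /hasP[u lu]; rewrite -!evv_mulP => e; apply/mem_pmP; exists u => //.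
case/orP: e => /eqP e; rewrite -scalemxAr e; first by exists s.
by exists (~~ s); rewrite evv_neg; case: s; rewrite !(expr0, expr1) ?scaleN1r ?scale1r ?opprK.
Qed.

Definition check_table (ct : seq citem) : bool :=
  [&& has (fun p => p.1 != [::]) ct,
      all (fun p => all (fun q =>
        has (fun u => cmem_pm u q.1) p.1 ==> (p.2 == q.2)) ct) ct,
      all (fun p => all (fun v => cmv p.2 v == cdbl v) p.1) ct,
      all (fun p => cmm p.2 (ctr p.2)
        == mkm (fun i j => if i == j then (4, 0) else (0, 0))) ct,
      all (fun p => all (fun q => has (fun r =>
        all (fun v => csol p.2 v r.1) q.1 &&
        (cmm r.2 p.2 == cmm p.2 q.2)) ct) ct) ct
    & all (fun p => let M := ctr p.2 in all (fun q => has (fun r =>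
        all (fun v => csol M v r.1) q.1) ct) ct) ct].

Definition table_vertices (ct : seq citem) : set 'cV[R]_4 :=
  [set v | exists2 p, p \in ct & mem_pm v [seq evv u | u <- p.1]].

Lemma check_tableP (ct : seq citem) : check_table ct ->
  cell_axioms (table_vertices ct) (rotation [seq evi p | p <- ct]).
Proof.
case/and5P => ne /allP disj /allP fixT /allP orthT /andP[/allP conjT /allP invT].
have rotE p v : p \in ct -> mem_pm v [seq evv u | u <- p.1] ->
    rotation [seq evi p | p <- ct] v = evm p.2.
  move=> pct pv; rewrite /rotation.
  set T := map _ _; set P := fun p : seq 'cV[R]_4 * 'M[R]_4 => _.
  have : evi p \in [seq x <- T | P x] by rewrite mem_filter map_f // andbT.
  case E: [seq x <- T | P x] => [//|x s] _.
  have : x \in [seq x <- T | P x] by rewrite E mem_head.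
  rewrite mem_filter => /andP[Px /mapP[q qct xq]]; rewrite xq /=.
  case/mem_pmP: pv => u pu [b vE]; have := disj p pct => /allP/(_ q qct)/implyP.
  move=> /(_ _)/eqP -> //; apply/hasP; exists u => //; rewrite -mem_pm_ev.
  move: Px; rewrite /P xq /= -/(mem_pm _ _) vE /mem_pm.
  case: b {vE}; rewrite ?expr0 ?expr1 ?scale1r // scaleN1r opprK orbC.
  by [].
have orthR p : p \in ct -> evm p.2 *m (evm p.2)^T = 1%:M.
  move=> /orthT/eqP e; rewrite evm_tr evm_mul e.
  apply/matrixP => i j; rewrite !mxE cgetm_mkm // val_eqE.
  case: eqP => _; last by rewrite -ev_0 !mulr0.
  by rewrite /ev /= mul0r addr0; lra.
have unitR p : p \in ct -> evm p.2 \in unitmx.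
  by move=> pct; case: (mulmx1_unit (orthR p pct)).
have step p q v : p \in ct -> q \in ct -> mem_pm v [seq evv u | u <- q.1] ->
    exists r, [/\ r \in ct, mem_pm (evm p.2 *m v) [seq evv u | u <- r.1]
      & evm r.2 = evm p.2 *m evm q.2 *m invmx (evm p.2)].
  move=> pct qct /mem_pmP[u qu [s ->]].
  have := conjT p pct => /allP/(_ q qct)/hasP[r rct].
  case/andP=> /allP/(_ u qu)/csolP sol /eqP e; exists r; split => //.
  by rewrite evm_mul -e -evm_mul mulmxK ?unitR.
split.
- case/hasP: ne => p pct; case E: p.1 => [//|u l] _.
  exists (evv u); exists p => //; apply/mem_pmP; exists u; first by rewrite E mem_head.
  by exists false; rewrite expr0 scale1r.
- by move=> v [p pct pv]; rewrite (rotE p) ?unitR.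
- move=> v [p pct pv]; rewrite /cell_map (rotE p) //.
  case/mem_pmP: pv => u pu [s ->]; rewrite -scalemxAr; congr (_ *: _).
  by apply/eqP; rewrite evv_mulP; apply: (allP (fixT p pct)).
- move=> w [p pct pw]; rewrite /cell_map (rotE p) //; apply/seteqP; split => v.
    case=> x [q qct qx] <-; have [r [rct rv _]] := step p q x pct qct qx.
    by exists r.
  case=> q qct /mem_pmP[u qu [s ->]].
  exists ((evm p.2)^T *m ((-1) ^+ s *: evv u)); last first.
    by rewrite mulmxA orthR // mul1mx.
  have := invT p pct => /allP/(_ q qct)/hasP[r rct /allP/(_ u qu) sol].
  by exists r => //; rewrite evm_tr; apply: csolP.
- move=> v w [q qct qv] [p pct pw]; have [r [rct rv e]] := step p q v pct qct qv.
  by rewrite /cell_map (rotE p w) // (rotE q v) // (rotE r).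
Qed.

Definition check_vertices (cl : seq cvec) (ct : seq citem) : bool :=
  all (fun c => has (fun p => cmem_pm c p.1) ct) cl &&
  all (fun p => all (fun u => has (fun c => cnorm c == cnorm u) cl &&
    has (fun c => cnorm c == cnorm (cvneg u)) cl) p.1) ct.

Lemma check_verticesP (V : set 'cV[R]_4) (cl : seq cvec) (ct : seq citem) :
  (forall v, V v <-> exists2 c, c \in cl & v = evv c) ->
  check_vertices cl ct -> V = table_vertices ct.
Proof.
move=> VP /andP[/allP clP /allP ctP]; apply/seteqP; split => v.
  case/VP => c ccl ->; have /hasP[p pct pc] := clP c ccl.
  by exists p; rewrite // mem_pm_ev.
case=> p pct /mem_pmP[u pu [s ->]]; apply/VP.
have /andP[/hasP[c ccl cu] /hasP[d dcl du]] := allP (ctP p pct) u pu.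
case: s; rewrite ?expr0 ?expr1 ?scale1r ?scaleN1r -?evv_neg.
  by exists d => //; apply/esym/eqP; rewrite evv_eq.
by exists c => //; apply/esym/eqP; rewrite evv_eq.
Qed.

Definition bools := [:: false; true].

Definition cverts16 : seq cvec :=
  [seq cunit i (csgn s (2, 0)) | i <- iota 0 4, s <- bools].

Lemma bools_mem s : s \in bools. Proof. by case: s. Qed.

Lemma ord_iota (i : 'I_4) : (i : nat) \in iota 0 4.
Proof. by rewrite mem_iota ltn_ord. Qed.

Lemma iota_ord k : k \in iota 0 4 -> exists i : 'I_4, k = i.
Proof. by rewrite mem_iota => k4; exists (Ordinal (k4 : (k < 4)%N)). Qed.

Lemma cunit1 (i : 'I_4) (s : bool) : (-1) ^+ s *: e i = evv (cunit i (csgn s (2, 0))).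
Proof.
rewrite evv_unit ev_sgn -ev_2 mulrC -mulrA mulfV ?mulr1 //.
by rewrite pnatr_eq0.
Qed.

Lemma vertices16P v :
  vertices16 v <-> exists2 c, c \in cverts16 & v = evv c.
Proof.
split=> [[i [s ->]]|[c /allpairsP[[k s] /= [/iota_ord[i ->] _ ->]] ->]].
  exists (cunit i (csgn s (2, 0))); last exact: cunit1.
  by apply/allpairsP; exists (i : nat, s); rewrite /= ord_iota bools_mem.
by exists i, s; rewrite cunit1.
Qed.

Definition pairs4 := [seq (i, j) | i <- iota 0 4, j <- iota 0 4].
Definition bools2 := [seq (s, t) | s <- bools, t <- bools].

Definition cverts24 : seq cvec :=
  [seq cvadd (cunit x.1 (csgn y.1 (2, 0))) (cunit x.2 (csgn y.2 (2, 0)))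
  | x <- [seq x <- pairs4 | (x.1 < x.2)%N], y <- bools2].

Lemma vertices24P v :
  vertices24 v <-> exists2 c, c \in cverts24 & v = evv c.
Proof.
split=> [[i [j [s [t [ij ->]]]]]|[c /allpairsP[[[k l] [s t]] [xP _ ->]] ->]].
  exists (cvadd (cunit i (csgn s (2, 0))) (cunit j (csgn t (2, 0)))).
    apply/allpairsP; exists ((i : nat, j : nat), (s, t)); split.
      rewrite mem_filter; apply/andP; split=> //; apply/allpairsP.
      by exists (i : nat, j : nat); rewrite /= !ord_iota.
      by case: s t => [] [].
    by [].
  by rewrite evv_add -!cunit1.
move: xP; rewrite mem_filter => /andP[/= kl /allpairsP[[k' l']]].
move=> [/iota_ord[i /= ei] /iota_ord[j /= ej] [ek el]]; rewrite ek el ei ej in kl *.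
by exists i, j, s, t; split; rewrite // evv_add -!cunit1.
Qed.

(* codd i j k is the sign of the permutation of {0, 1, 2, 3} that maps 0, 1, 2
   to i, j, k, computed by sorting with transpositions (see odd_perm4). *)
Definition sw (a b x : nat) := if x == a then b else if x == b then a else x.
Definition codd (i j k : nat) : bool :=
  let j' := sw 0 i j in
  let k' := sw 1 j' (sw 0 i k) in
  (0 != i) (+) (1 != j') (+) (2 != k').
Definition cdistinct (i j k : nat) := [&& i != j, i != k & j != k].

Lemma val_tperm (i j k : 'I_4) : tperm i j k = sw i j k :> nat.
Proof.
rewrite /sw !val_eqE; case: tpermP => [->|->|/eqP/negPf -> /eqP/negPf -> //].
  by rewrite eqxx.
by case: eqP => [->|]; rewrite ?eqxx.
Qed.

Lemma odd_perm4 (s : 'S_4) : s = codd (s 0) (s 1) (s 2) :> bool.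
Proof.
pose s1 := (s * tperm 0%R (s 0%R))%g.
pose s2 := (s1 * tperm 1%R (s1 1%R))%g.
pose s3 := (s2 * tperm 2%R (s2 2%R))%g.
have s1_0 : s1 0 = 0 by rewrite permM tpermR.
have s2_0 : s2 0 = 0.
  by rewrite permM s1_0 tpermD // -[X in _ != X]s1_0 (inj_eq perm_inj).
have s2_1 : s2 1 = 1 by rewrite permM tpermR.
have s3_0 : s3 0 = 0.
  by rewrite permM s2_0 tpermD // -[X in _ != X]s2_0 (inj_eq perm_inj).
have s3_1 : s3 1 = 1.
  by rewrite permM s2_1 tpermD // -[X in _ != X]s2_1 (inj_eq perm_inj).
have s3_2 : s3 2 = 2 by rewrite permM tpermR.
have s3_id : s3 = 1%g.
  have fix3 x : x != 3 -> s3 x = x.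
    case: x => -[|[|[|[|//]]]] x4 //= _.
    - by rewrite (_ : Ordinal x4 = 0) //; apply: val_inj.
    - by rewrite (_ : Ordinal x4 = 1) //; apply: val_inj.
    - by rewrite (_ : Ordinal x4 = 2) //; apply: val_inj.
  apply/permP => x; rewrite perm1; case: (eqVneq x 3) => [->|/fix3 //].
  apply/eqP; apply: contraT => s33; have := fix3 _ s33 => /perm_inj s3E.
  by rewrite s3E eqxx in s33.
have : odd_perm s3 = false by rewrite s3_id odd_perm1.
rewrite !odd_permM !odd_tperm => e; apply/esym.
have v1 x : s1 x = sw 0 (s 0) (s x) :> nat by rewrite permM val_tperm.
have v2 : s2 2 = sw 1 (s1 1) (s1 2) :> nat by rewrite permM val_tperm.
move: e; rewrite /codd -!v1 -v2 -!(inj_eq val_inj) /=.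
by case: (odd_perm s); do 3 case: (_ != _).
Qed.

Lemma perm4_exists (i j k : 'I_4) : cdistinct i j k ->
  exists s : 'S_4, [/\ s 0 = i, s 1 = j & s 2 = k].
Proof.
move=> ijk.
pose t1 := tperm 0 i; pose t2 := tperm 1 (t1 j); pose t3 := tperm 2 (t2 (t1 k)).
exists (t3 * t2 * t1)%g; split; apply: val_inj;
  rewrite /= !permM !val_tperm; move: ijk; clear.
all: case: i => -[|[|[|[|//]]]] ?; case: j => -[|[|[|[|//]]]] ?.
all: by case: k => -[|[|[|[|//]]]] ?.
Qed.

Definition triples4 := [seq (i, x) | i <- iota 0 4, x <- pairs4].
Definition bools3 := [seq (s, x) | s <- bools, x <- bools2].
Definition bools4 := [seq (s, x) | s <- bools, x <- bools3].
Definition cgen600 (x : nat * (nat * nat)) (y : bool * (bool * bool)) : cvec :=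
  cvadd (cvadd (cunit x.1 (csgn y.1 (0, 1))) (cunit x.2.1 (csgn y.2.1 (1, 0))))
    (cunit x.2.2 (csgn y.2.2 (-1, 1))).

Definition chalf600 (y : bool * (bool * (bool * bool))) : cvec :=
  cvadd (cvadd (cvadd (cunit 0 (csgn y.1 (1, 0))) (cunit 1 (csgn y.2.1 (1, 0))))
    (cunit 2 (csgn y.2.2.1 (1, 0)))) (cunit 3 (csgn y.2.2.2 (1, 0))).

Definition even_triples := [seq x <- triples4 |
  cdistinct x.1 x.2.1 x.2.2 && ~~ codd x.1 x.2.1 x.2.2].

Definition cverts600 : seq cvec :=
  cverts16 ++ [seq chalf600 y | y <- bools4]
  ++ [seq cgen600 x y | x <- even_triples, y <- bools3].

Lemma bools3_mem s t u : (s, (t, u)) \in bools3. Proof. by case: s t u => [] [] []. Qed.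

Lemma bools4_mem s t u w : (s, (t, (u, w))) \in bools4.
Proof. by case: s t u w => [] [] [] []. Qed.

Lemma evv_half (i : 'I_4) s c :
  evv (cunit i (csgn s c)) = 2^-1 *: (((-1) ^+ s * ev c) *: e i).
Proof. by rewrite evv_unit ev_sgn scalerA. Qed.

Lemma cgen600E (i j k : 'I_4) (s t u : bool) :
  evv (cgen600 (nat_of_ord i, (nat_of_ord j, nat_of_ord k)) (s, (t, u))) =
  2^-1 *: (((-1) ^+ s * phi) *: e i + (-1) ^+ t *: e j
           + ((-1) ^+ u * phi^-1) *: e k).
Proof.
by rewrite !evv_add !evv_half -ev_phi -ev_1 -ev_phiV mulr1 !scalerDr.
Qed.

Lemma chalf600E (s t u w : bool) :
  evv (chalf600 (s, (t, (u, w)))) =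
  2^-1 *: ((-1) ^+ s *: e 0 + (-1) ^+ t *: e 1
           + (-1) ^+ u *: e 2 + (-1) ^+ w *: e 3).
Proof.
rewrite !evv_add (evv_half 0) (evv_half 1) (evv_half 2) (evv_half 3).
by rewrite -ev_1 !mulr1 !scalerDr.
Qed.

Lemma vertices600P v :
  vertices600 v <-> exists2 c, c \in cverts600 & v = evv c.
Proof.
rewrite /cverts600; split.
  case=> [[/vertices16P[c ccl ->]|[s [t [u [w ->]]]]]|[sg [s [t [u [sgA ->]]]]]].
  - by exists c => //; rewrite mem_cat ccl.
  - exists (chalf600 (s, (t, (u, w)))); last by rewrite chalf600E.
    rewrite mem_cat; apply/orP; right; rewrite mem_cat; apply/orP; left.
    exact/map_f/bools4_mem.
  exists (cgen600 (nat_of_ord (sg 0), (nat_of_ord (sg 1), nat_of_ord (sg 2)))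
    (s, (t, u))); last by rewrite cgen600E.
  do 2 (rewrite mem_cat; apply/orP; right).
  apply/allpairsP.
  exists ((nat_of_ord (sg 0), (nat_of_ord (sg 1), nat_of_ord (sg 2))), (s, (t, u))).
  split; [|exact: bools3_mem|by []].
  rewrite mem_filter; apply/andP; split.
    rewrite -odd_perm4 -Alt_even sgA andbT.
    by rewrite /cdistinct !val_eqE !(inj_eq perm_inj).
  apply/allpairsP.
  exists (nat_of_ord (sg 0), (nat_of_ord (sg 1), nat_of_ord (sg 2))).
  split; [exact: ord_iota| |by []].
  apply/allpairsP; exists (nat_of_ord (sg 1), nat_of_ord (sg 2)).
  by rewrite /= !ord_iota.
case=> c; rewrite mem_cat => /orP[ccl vE|].
  by left; left; apply/vertices16P; exists c.
rewrite mem_cat => /orP[/mapP[[s [t [u w]]] _ cE] vE|+ vE].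
  by left; right; exists s, t, u, w; rewrite vE cE chalf600E.
case/allpairsP => -[[a [b d]] [s [t u]]] [xP _ cE]; right; rewrite {}vE {c}cE.
move: xP; rewrite mem_filter => /andP[/andP[/= abd ev_abd]].
case/allpairsP => -[a' bd'] [/iota_ord[i /= ->] + [ea ebd]].
case/allpairsP => -[b' d'] [/iota_ord[j /= ->] /iota_ord[k /= ->] ebd'].
move: ebd; rewrite ebd' => -[eb ed]; rewrite ea eb ed in abd ev_abd *.
have [sg [s0 s1 s2]] := perm4_exists abd.
exists sg, s, t, u; split; last by rewrite s0 s1 s2 cgen600E.
by rewrite Alt_even odd_perm4 s0 s1 s2.
Qed.

Lemma map_nil (A B : Type) (f : A -> B) : [::] = map f [::].
Proof. by []. Qed.

Lemma map_cons_eq (A B : Type) (f : A -> B) x x' s s' :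
  x = f x' -> s = map f s' -> x :: s = map f (x' :: s').
Proof. by move=> -> ->. Qed.

Lemma evi_eq l l' M M' :
  l = [seq evv u | u <- l'] -> M = evm M' -> (l, M) = evi (l', M').
Proof. by move=> -> ->. Qed.

Lemma nth_ev v i : (map ev v)`_i = ev (cget v i).
Proof.
have [iv|vi] := ltnP i (size v); first by rewrite (nth_map (0, 0)).
by rewrite /cget !nth_default ?size_map // ev_0.
Qed.

Lemma nth_evm M i j :
  (nth [::] [seq [seq ev x | x <- r] | r <- M] i)`_j = ev (cgetm M i j).
Proof.
rewrite -nth_ev; congr (_`_j).
have [iM|Mi] := ltnP i (size M); first by rewrite (nth_map [::]).
by rewrite !nth_default ?size_map.
Qed.

Lemma half_dbl c : 2^-1 * ev (cadd c c) = ev c.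
Proof. by rewrite ev_add; lra. Qed.

Lemma vec4_half a b c d v :
  [:: a; b; c; d] = [seq ev x | x <- v] -> 2^-1 *: vec4 a b c d = evv v.
Proof.
by move=> E; apply/colP => i; rewrite mxE evvE /vec4 mxE E nth_ev.
Qed.

Lemma vec4_full a b c d v :
  [:: a; b; c; d] = [seq ev x | x <- v] -> vec4 a b c d = evv (cdbl v).
Proof.
move=> E; apply/colP => i; rewrite evvE /vec4 mxE E nth_ev.
by rewrite cget_mkv // half_dbl.
Qed.

Lemma mx4_half rows M :
  rows = [seq [seq ev x | x <- r] | r <- M] -> 2^-1 *: mx4 rows = evm M.
Proof. by move=> ->; apply/matrixP => i j; rewrite mxE evmE /mx4 mxE nth_evm. Qed.

Lemma mx4_full rows M : rows = [seq [seq ev x | x <- r] | r <- M] ->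
  mx4 rows = evm (mkm (fun i j => cadd (cgetm M i j) (cgetm M i j))).
Proof.
move=> ->; apply/matrixP => i j; rewrite evmE cgetm_mkm // half_dbl.
by rewrite /mx4 mxE nth_evm.
Qed.

Ltac reify := lazymatch goal with
  | |- [::] = _ => exact: map_nil
  | |- _ :: _ = _ => eapply map_cons_eq; [reify | reify]
  | |- (_, _) = _ => eapply evi_eq; [reify | reify]
  | |- _ *: vec4 _ _ _ _ = _ => eapply vec4_half; reify
  | |- vec4 _ _ _ _ = _ => eapply vec4_full; reify
  | |- _ *: mx4 _ = _ => eapply mx4_half; reify
  | |- mx4 _ = _ => eapply mx4_full; reify
  | |- 0 = _ => exact ev_0
  | |- 1 = _ => exact ev_1
  | |- 2 = _ => exact ev_2
  | |- - 1 = _ => exact ev_N1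
  | |- phi = _ => exact ev_phi
  | |- - phi = _ => exact ev_Nphi
  | |- phi^-1 = _ => exact ev_phiV
  | |- - phi^-1 = _ => exact ev_NphiV
  | |- [seq _ | _ <- _] = _ => reflexivity
  | |- map _ _ = _ => reflexivity
  end.

Lemma cell_axiomsP (V : set 'cV[R]_4) (cl : seq cvec) (T : rotation_table)
    (ct : seq citem) :
  (forall v, V v <-> exists2 c, c \in cl & v = evv c) ->
  T = [seq evi p | p <- ct] ->
  check_vertices cl ct && check_table ct -> cell_axioms V (rotation T).
Proof.
by move=> VP -> /andP[/(check_verticesP VP) -> /check_tableP].
Qed.

Lemma cell16_axioms : cell_axioms vertices16 (rotation table16).
Proof.
eapply (cell_axiomsP vertices16P); first by rewrite /table16; reify.
by vm_compute.
Qed.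

Lemma cell24_axioms : cell_axioms vertices24 (rotation table24).
Proof.
eapply (cell_axiomsP vertices24P); first by rewrite /table24; reify.
by vm_compute.
Qed.

Lemma cell600_axioms : cell_axioms vertices600 (rotation table600).
Proof.
eapply (cell_axiomsP vertices600P); first by rewrite /table600; reify.
by vm_compute.
Qed.

Definition cell16_quandle : quandle := cell_quandle cell16_axioms.
Definition cell24_quandle : quandle := cell_quandle cell24_axioms.
Definition cell600_quandle : quandle := cell_quandle cell600_axioms.
End CellData.

(* Main.v *)
Require Import Defs.
From mathcomp Require Import all_boot all_algebra.
From mathcomp Require Import boolp classical_sets reals zify.
From mathcomp Require Import generic_quotient.

(* Let X be a quandle with points e, g_1, ..., g_m, indices modulo m, such that
   g_i * e = g_(i+1) and e * g_(i+1) = g_i. The inner automorphisms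
   T_i = S_(g_(i+1)) S_e^-1, where S_y x = x * y, satisfy the relations of the
   gamma_i, so G_m acts on X, and the orbit map F of e is a quandle homomorphism
   Q_m -> X with F(1) = e and F(gamma_i) = g_i. In each cell quandle such points
   exist, and F is bijective: a coset enumeration over the cyclic subgroup
   generated by gamma_1 bounds G_m by 8, 24, 120 elements, and F sends the
   corresponding normal forms to pairwise distinct vertices exhausting the
   vertex set. *)

Set Implicit Arguments.
Unset Strict Implicit.
Unset Printing Implicit Defensive.
Import GRing.Theory Num.Theory.

Lemma quandle_isomorphic_sym (X Y : quandle) :
  quandle_isomorphic X Y -> quandle_isomorphic Y X.
Proof.
case=> f [[h fK hK] fM]; exists h; split; first by exists f.
by move=> x y; rewrite -{1}[x]hK -{1}[y]hK -fM fK.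
Qed.

Lemma uniq_map_inj_in (A B : eqType) (f : A -> B) (s : seq A) :
  uniq (map f s) -> {in s &, injective f}.
Proof.
elim: s => // x s IH /= /andP[fx fs] y z.
rewrite !inE => /predU1P[->|ys] /predU1P[->|zs] // E; last exact: IH.
  by rewrite E map_f in fx.
by rewrite -E map_f in fx.
Qed.

(** * Homomorphisms from the knot quandle to a quandle *)

Section FiberHom.
Variables (m : nat) (X : quandle) (e : X) (g : 'I_m -> X).
Local Notation "x ** y" := (qop x y) (at level 40, left associativity).
Local Notation gam := (@fiber_gen m).
Local Open Scope group_scope.
Local Open Scope quotient_scope.
Hypothesis ge : forall i, g i ** e = g (ordS i).
Hypothesis eg : forall i, e ** g (ordS i) = g i.

Lemma fiber_ind (P : fiber_group m -> Prop) :
  P 1 -> (forall x i, P x -> P (x * gam i)) ->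
  (forall x i, P x -> P (x * (gam i)^-1)) -> forall x, P x.
Proof.
move=> P1 PM PV x; elim/fiber_W: x => u.
elim/last_ind: u => [//|u [i b] IH]; rewrite -cats1.
have E b' : (\pi_(fiber_group m) (u ++ [:: (i, b')]) : fiber_group m) =
    \pi_(fiber_group m) u * \pi_(fiber_group m) [:: (i, b')].
  by rewrite [RHS]pres_mul_pi.
rewrite E; case: b; last exact: PM.
suff -> : (\pi_(fiber_group m) [:: (i, true)] : fiber_group m) = (gam i)^-1.
  exact: PV.
by rewrite [RHS]pres_inv_pi.
Qed.

(** The last clause is [F (x * gam i) = T_i (F x)]: the point [y] with [F x = y ** e] stands for the
    image of [F x] under S_e^-1. *)
Lemma fiber_hom : exists F : fiber_group m -> X,
  [/\ forall x y, F (trefoil_op x y) = F x ** F y, F 1 = e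
    & forall i x y, F x = y ** e -> F (x * gam i) = y ** g (ordS i)].
Proof.
have surj y : exists x, x ** e = y.
  by have [f _ fK] := qop_bij e; exists (f y); apply: fK.
have /choice[T TE] (i : 'I_m) : exists t : X -> X,
    bijective t /\ forall x, t (x ** e) = x ** g (ordS i).
  have [f fK Kf] := qop_bij e; exists (fun y => f y ** g (ordS i)).
  split=> [|x]; last by rewrite fK.
  by apply: (bij_comp (qop_bij _)); exists (fun w => w ** e).
have /choice[T' T'K] (i : 'I_m) : exists t, cancel (T i) t /\ cancel t (T i).
  by have [[t tK Kt] _] := TE i; exists t.
have {}TE i x : T i (x ** e) = x ** g (ordS i) by case: (TE i).
(* With [x] written as [(z ** e) ** e], both sides become [(z ** g (ordS i)) ** g i]. Words act on
   the right, so the left factor [gamma_(i+1)] acts first. *)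
have Trel i x : T (ord_pred i) (T (ordS i) x) = T i x.
  have [y <-] := surj x; have [z <-] := surj y.
  rewrite !TE -(ge (ordS i)) -qop_dist TE ord_predK.
  by rewrite [RHS]qop_dist eg.
have Tmor i x y : T i (x ** y) = T i x ** T i y.
  have [x' <-] := surj x; have [y' <-] := surj y.
  by rewrite -qop_dist !TE qop_dist.
(* Conjugation by S_e shifts the index of T_i, as the monodromy shifts that of gamma_i; hence
   [Fmono]. *)
have Te i x : T (ordS i) (x ** e) = T i x ** e.
  by have [y <-] := surj x; rewrite !TE [RHS]qop_dist ge.
pose act x (a : 'I_m * bool) := if a.2 then T' a.1 x else T a.1 x.
have actP u v : pres_eq (@trefoil_rel m) u v ->
    forall x, foldl act x u = foldl act x v.
  elim=> {u v} [//|u v _ IH x|u v w _ IH1 _ IH2 x|u1 u2 v1 v2 _ IH1 _ IH2 x| |].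
  - by rewrite IH.
  - by rewrite IH1.
  - by rewrite !foldl_cat IH1 IH2.
  - by move=> i [] x /=; rewrite /act /=; case: (T'K i) => K1 K2; rewrite ?K1 ?K2.
  by move=> _ _ [i [-> ->]] x /=; rewrite /act /= Trel.
pose F (x : fiber_group m) := foldl act e (repr x).
have FE u : F (\pi_(fiber_group m) u) = foldl act e u.
  exact/actP/pres_reprK.
have F1 : F 1 = e by rewrite FE.
have FM x i : F (x * gam i) = T i (F x).
  by elim/fiber_W: x => u; rewrite [_ * _]pres_mul_pi !FE foldl_cat.
have FV x i : F (x * (gam i)^-1) = T' i (F x).
  by rewrite -[in RHS](mulgVK (gam i) x) FM (T'K i).1.
exists F; split=> //; last by move=> i x y Fx; rewrite FM Fx TE.
have Fmono x : F (monodromy x) = F x ** e.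
  elim/fiber_ind: x => [|x i IH|x i IH].
  - by rewrite monodromy1 F1 qopxx.
  - by rewrite monodromyM monodromy_gen !FM IH Te.
  - rewrite monodromyM monodromyV monodromy_gen !FV IH.
    by rewrite -{1}[F x](T'K i).2 -Te (T'K _).1.
(* Since x * (y gamma_i) = ((x gamma_i^-1) * y) gamma_i, with * the quandle operation, and T_i is an
   automorphism, the induction on [y] must leave [x] free. *)
move=> x y; elim/fiber_ind: y x => [|y i IH|y i IH] x.
- by rewrite /trefoil_op invg1 !mulg1 Fmono F1.
- rewrite FM -[in RHS](mulgVK (gam i) x) FM -Tmor -IH -FM /trefoil_op.
  by rewrite invgM !mulgA.
- have -> : trefoil_op x (y * (gam i)^-1) = trefoil_op (x * gam i) y * (gam i)^-1.
    by rewrite /trefoil_op invgM invgK !mulgA.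
  rewrite !FV IH FM; apply: (can_inj (T'K i).1).
  by rewrite Tmor !(T'K i).2.
Qed.
End FiberHom.

(** * Integer powers in a group *)

Section IntegerPower.
Variables (G : groupType) (c : G).
Local Open Scope group_scope.

Definition zexpg (z : int) : G :=
  match z with Posz k => c ^+ k | Negz k => c ^- k.+1 end.

Lemma zexpgS z : zexpg (z + 1)%R = zexpg z * c.
Proof.
case: z => k; first by rewrite -PoszD addn1 /= expgSr.
case: k => [|k]; first by rewrite /= expg1 mulVg.
have -> : (Negz k.+1 + 1)%R = Negz k by lia.
by rewrite /= [c ^+ k.+2]expgS invgM mulgVK.
Qed.

Lemma zexpgD y z : zexpg (y + z)%R = zexpg y * zexpg z.
Proof.
elim/int_rect: z => [|k IH|k IH]; first by rewrite addr0 mulg1.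
  by rewrite -addn1 PoszD addrA !zexpgS IH mulgA.
apply: (mulIg c); rewrite -mulgA -!zexpgS.
have -> : (- k.+1%:Z + 1 = - k%:Z)%R by lia.
by rewrite -IH; congr zexpg; lia.
Qed.

Lemma zexpgBK y z : zexpg z * zexpg (y - z)%R = zexpg y.
Proof. by rewrite -zexpgD addrC subrK. Qed.

Lemma zexpg_mod n z : 0 < n -> c ^+ n = 1 ->
  exists2 a, a < n & zexpg z = c ^+ a.
Proof.
move=> n0 cn; have cmod k : c ^+ k = c ^+ (k %% n).
  by rewrite {1}(divn_eq k n) mulnC expgnDr expgnA cn expg1n mul1g.
suff [k ->] : exists k, zexpg z = c ^+ k.
  by exists (k %% n); rewrite ?ltn_mod -?cmod.
case: z => k; first by exists k.
(* This exponent exceeds -(k+1) by the multiple (k+1)n of n. *)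
exists (k.+1 * n.-1)%N; apply: (mulIg (c ^+ k.+1)); rewrite mulVg -expgnDr.
by rewrite -mulnSr prednK // mulnC expgnA cn expg1n.
Qed.
End IntegerPower.

(** * Coset enumeration over the subgroup generated by [gamma_0] *)

Section CosetEnumeration.
Variables (m : nat) (words : seq (seq nat)).

Definition succ_mod i := i.+1 %% m.
(** Adding [m] before the truncated predecessor sends 0 to [m - 1]. *)
Definition pred_mod i := (i + m).-1 %% m.

(* With w_k the k-th word, the fact ((k, i), (a, l)) stands for
   w_k * gamma_i = gamma_0 ^ a * w_l. *)
Definition fact : Type := (nat * nat) * (int * nat).

Definition edges := [seq (k, i) | k <- iota 0 (size words), i <- iota 0 m].

Definition lookup (s : seq fact) (x : nat * nat) :=
  ohead [seq f.2 | f <- s & f.1 == x].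

(** The first fact says that [gamma_0] lies in the subgroup; for a prefix-closed list of words the
    others form a spanning tree of the Schreier graph. *)
Definition tree_facts : seq fact :=
  ((0, 0), (1%Z, 0)) ::
  [seq (x, (0%Z, index (rcons (nth [::] words x.1) x.2) words))
  | x <- edges & rcons (nth [::] words x.1) x.2 \in words].

(* Two known sides of the triangle gamma_i = gamma_(i+1) gamma_(i-1) starting at
   w_k determine the third one. *)
Definition deduce (s : seq fact) (x : nat * nat) : seq fact :=
  let: (k, i) := x in
  match lookup s (k, succ_mod i), lookup s (k, i) with
  | Some (b, p), o => match lookup s (p, pred_mod i), o with
    | Some (b', l), None => ((k, i), ((b + b')%R, l)) :: s
    | None, Some (a, l) => ((p, pred_mod i), ((a - b)%R, l)) :: s
    | _, _ => s
    end
  | None, Some (a, l) =>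
    if [seq f <- s | (f.1.2 == pred_mod i) && (f.2.2 == l)] is f :: _
    then ((k, succ_mod i), ((a - f.2.1)%R, f.1.1)) :: s else s
  | None, None => s
  end.

Definition facts rounds := iter rounds (fun s => foldl deduce s edges) tree_facts.

(* A triangle with known sides that closes up only up to gamma_0 ^ n forces
   gamma_0 ^ n = 1. *)
Definition order_fact n (s : seq fact) (x : nat * nat) :=
  if (lookup s x, lookup s (x.1, succ_mod x.2)) is (Some (a, l), Some (b, p)) then
    lookup s (p, pred_mod x.2) == Some ((a + Posz n - b)%R, l)
  else false.

(** The last two tests make the normal forms stable under right multiplication by generators (a fact
    leaves each coset) and by their inverses (a fact enters each coset). *)
Definition complete rounds n :=
  let s := facts rounds in
  [&& nth [::] words 0 == [::], 0 < size words, 0 < n,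
      has (order_fact n s) edges,
      all (fun x => has (fun f => (f.1 == x) && (f.2.2 < size words)) s) edges
    & all (fun x => has (fun f => [&& f.1.2 == x.2, f.2.2 == x.1
        & f.1.1 < size words]) s) edges].

Variables (G : groupType) (gam : nat -> G).
Hypothesis gam_rel : forall i, i < m -> (gam i = gam (succ_mod i) * gam (pred_mod i))%g.
Local Open Scope group_scope.
Local Notation c := (gam 0).

Definition word_val (u : seq nat) : G := \prod_(i <- u) gam i.
Local Notation w k := (word_val (nth [::] words k)).

Definition holds (f : fact) :=
  w f.1.1 * gam f.1.2 = zexpg c f.2.1 * w f.2.2.

Lemma lookupP s x y : lookup s x = Some y -> (x, y) \in s.
Proof.
rewrite /lookup; case E: [seq f <- s | f.1 == x] => [//|f t] [<-].
have : f \in [seq f <- s | f.1 == x] by rewrite E mem_head.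
by rewrite mem_filter => /andP[/eqP <-]; case: f {E}.
Qed.

Lemma edgesP k i : ((k, i) \in edges) = (k < size words) && (i < m).
Proof.
apply/allpairsP/andP => [[[k' i']] /= [kk ii [-> ->]]|[kk ii]].
  by move: kk ii; rewrite !mem_iota.
by exists (k, i); rewrite /= !mem_iota.
Qed.

Lemma tree_holds : nth [::] words 0 = [::] -> {in tree_facts, forall f, holds f}.
Proof.
move=> w0 f; rewrite inE => /predU1P[->|].
  by rewrite /holds /= w0 /word_val big_nil mulg1 mul1g.
case/mapP => x; rewrite mem_filter => /andP[xw _] ->.
by rewrite /holds /= nth_index // /word_val -cats1 big_cat big_seq1 mul1g.
Qed.

Lemma deduce_holds s x : x \in edges -> {in s, forall f, holds f} ->
  {in deduce s x, forall f, holds f}.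
Proof.
case: x => k i; rewrite edgesP => /andP[_ im] sP /=.
have look y z : lookup s y = Some z -> holds (y, z) by move/lookupP/sP.
have rel := gam_rel im.
case E1: (lookup s (k, succ_mod i)) => [[b p]|]; last first.
  case E2: (lookup s (k, i)) => [[a l]|//].
  case E: [seq f <- s | _] => [//|f t] h; rewrite inE => /predU1P[->|]; last exact: sP.
  have : f \in [seq f <- s | (f.1.2 == pred_mod i) && (f.2.2 == l)].
    by rewrite E mem_head.
  rewrite mem_filter => /andP[/andP[/eqP fi /eqP fl] /sP].
  have := look _ _ E2; rewrite /holds /= fi fl => H1 H2.
  (* With [p = f.1.1], both w_k gamma_(i+1) and c^(a - f.2.1) w_p become c^a w_l after
     multiplication by gamma_(i-1). *)
  apply: (mulIg (gam (pred_mod i))); rewrite -mulgA -rel H1 -mulgA H2 mulgA.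
  by rewrite -zexpgD subrK.
have H1 := look _ _ E1; rewrite /holds /= in H1.
case E2: (lookup s (p, pred_mod i)) => [[b' l]|].
  case: (lookup s (k, i)) => [//|] h; rewrite inE => /predU1P[->|]; last exact: sP.
  have := look _ _ E2; rewrite /holds /= => H2.
  by rewrite rel mulgA H1 -mulgA H2 mulgA zexpgD.
case E3: (lookup s (k, i)) => [[a l]|//] h; rewrite inE => /predU1P[->|]; last exact: sP.
have := look _ _ E3; rewrite /holds /= => H3.
by apply: (mulgI (zexpg c b)); rewrite !mulgA -H1 zexpgBK -H3 -mulgA -rel.
Qed.

Lemma facts_hold rounds : nth [::] words 0 = [::] ->
  {in facts rounds, forall f, holds f}.
Proof.
move=> w0; elim: rounds => [|r IH]; first exact: tree_holds.
rewrite /facts iterS -/(facts r).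
(* The induction is on the folded list only; its inclusion in [edges] is kept because it bounds the
   generator index. *)
have : {subset edges <= edges} by [].
elim: {1 3}edges (facts r) IH => [//|x t IHt] s sP sub /=.
apply: IHt => [|y yt]; last by apply: sub; rewrite inE yt orbT.
by apply: deduce_holds => //; apply: sub; apply: mem_head.
Qed.

Lemma order_factP n s x : x \in edges -> {in s, forall f, holds f} ->
  order_fact n s x -> c ^+ n = 1.
Proof.
case: x => k i; rewrite edgesP /order_fact => /andP[_ im] sP /=.
have look y z : lookup s y = Some z -> holds (y, z) by move/lookupP/sP.
case E1: (lookup s (k, i)) => [[a l]|//].
case E2: (lookup s (k, succ_mod i)) => [[b p]|//].
move=> /eqP/look; move: (look _ _ E1) (look _ _ E2); rewrite /holds /=.
(* The long side of the triangle gives c^a w_l, the two short ones c^b c^(a+n-b) w_l. *)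
rewrite (gam_rel im) mulgA => + E; rewrite E -mulgA => + E'.
rewrite E' mulgA zexpgBK zexpgD => /mulIg.
by rewrite -{2}[zexpg c a]mulg1 => /mulgI.
Qed.

(** Only an upper bound is claimed: normal forms may still coincide, until the images under F
    separate them. *)
Lemma coset_enumeration rounds n : complete rounds n ->
  let S x := exists a k, [/\ a < n, k < size words & x = c ^+ a * w k] in
  [/\ S 1, forall x i, i < m -> S x -> S (x * gam i)
    & forall x i, i < m -> S x -> S (x * (gam i)^-1)].
Proof.
case/and5P => /eqP w0 sw n0 /hasP[x0 x0e ord] /andP[/allP fwd /allP bwd] S.
have hold := @facts_hold rounds w0; have cn := order_factP x0e hold ord.
have SP z k : k < size words -> S (zexpg c z * w k).
  by move=> ks; have [a an ->] := zexpg_mod z n0 cn; exists a, k.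
split.
- by exists 0, 0; split; rewrite // w0 /word_val big_nil mulg1.
- move=> x i im [a [k [_ ks ->]]].
  have /fwd/hasP[f /hold fh /andP[/eqP fki fs]] : (k, i) \in edges.
    by rewrite edgesP ks.
  move: fh; rewrite /holds fki /= -mulgA => ->.
  rewrite mulgA -[c ^+ a]/(zexpg c a) -zexpgD; exact: SP.
- move=> x i im [a [k [_ ks ->]]].
  have /bwd/hasP[f /hold fh /and3P[/eqP fi /eqP fk fs]] : (k, i) \in edges.
    by rewrite edgesP ks.
  move: fh; rewrite /holds fi fk /= => fh.
  have -> : c ^+ a * w k * (gam i)^-1 = zexpg c (Posz a - f.2.1)%R * w f.1.1.
    apply: (mulIg (gam i)); rewrite mulgVK -mulgA fh mulgA -zexpgD subrK.
    by [].
  exact: SP.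
Qed.
End CosetEnumeration.

(** * Certificates on encoded vectors and matrices *)

Definition id_code : cmat := mkm (fun i j => if i == j then (2, 0)%R else (0, 0)%R).

Definition code_rotation (ct : seq citem) (u : cvec) : cmat :=
  if [seq p <- ct | cmem_pm u p.1] is p :: _ then p.2 else id_code.

(** The product [cmv] of two codes encodes twice the product of what they encode. The floors are
    exact only on even entries. *)
Definition half_code (v : cvec) : cvec :=
  mkv (fun i => ((cget v i).1 %/ 2, (cget v i).2 %/ 2)%Z).

(* If u encodes F x and M0, M1 are the matrices of F 1 and F gamma_(i+1), then
   the result encodes F (x * gamma_i); the two tests certify the halvings. *)
Definition code_step (M0 M1 : cmat) (u : cvec) : option cvec :=
  let y := half_code (cmv (ctr M0) u) in
  let v := half_code (cmv M1 y) in
  if (cmv M0 y == cdbl u) && (cmv M1 y == cdbl v) then Some v else None.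

(** The letter [i] uses the matrix of [g_(i+1)], as T_i does; [None] records a failed halving. *)
Definition code_path (M0 : cmat) (Ms : seq cmat) (u : cvec) (w : seq nat) :=
  foldl (fun o i => obind (code_step M0 (nth [::] Ms (succ_mod (size Ms) i))) o)
    (Some u) w.

(** [L] lists the codes of the images under F of the normal forms [gamma_0 ^ a * w_k]: [uniq L]
    yields injectivity, the last test surjectivity. Codes are compared after [cnorm], where equality
    means equality of vectors. *)
Definition iso_check (cl : seq cvec) (ct : seq citem) (e : cvec) (gs : seq cvec)
    (words : seq (seq nat)) (rounds n : nat) : bool :=
  let M0 := code_rotation ct e in
  let Ms := map (code_rotation ct) gs in
  let m := size gs in
  let P := [seq (a, k) | a <- iota 0 n, k <- iota 0 (size words)] in
  let L := [seq omap cnorm (code_path M0 Ms e (nseq x.1 0 ++ nth [::] words x.2))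
           | x <- P] in
  [&& complete m words rounds n, e \in cl, all (mem cl) gs,
      all (fun i => cmv M0 (nth [::] gs i) == cdbl (nth [::] gs (succ_mod m i)))
        (iota 0 m),
      all (fun i => cmv (nth [::] Ms (succ_mod m i)) e == cdbl (nth [::] gs i))
        (iota 0 m),
      all isSome L, uniq L & all (fun c => Some (cnorm c) \in L) cl].

(** * From certificates to isomorphisms *)

Section CellIsomorphism.
Variable R : realType.
Local Open Scope ring_scope.
Local Notation evv := (@evv R).
Local Notation evm := (@evm R).
Local Notation evi := (@evi R).

Lemma evm_id : evm id_code = 1%:M.
Proof.
apply/matrixP => i j; rewrite evmE cgetm_mkm // mxE val_eqE.
case: eqP => _; last by rewrite -ev_0 mulr0.
by rewrite -ev_2 mulVf // pnatr_eq0.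
Qed.

Lemma rotation_evv (ct : seq citem) u :
  rotation [seq evi p | p <- ct] (evv u) = evm (code_rotation ct u).
Proof.
rewrite /rotation /code_rotation filter_map.
rewrite (@eq_filter _ _ (fun p : citem => cmem_pm u p.1)) => [|p].
  by case: [seq p <- ct | _] => [|p t] //=; rewrite evm_id.
exact: mem_pm_ev.
Qed.

Variables (V : set 'cV[R]_4) (cl : seq cvec) (T : rotation_table R).
Variables (ct : seq citem).
Hypothesis VT : cell_axioms V (rotation T).
Hypothesis VP : forall v, V v <-> exists2 c, c \in cl & v = evv c.
Hypothesis TE : T = [seq evi p | p <- ct].
Local Notation X := (cell_quandle VT).
Local Notation pos x := (val (x : cell_set V (rotation T))).1.

Lemma cell_point u : u \in cl -> exists x : X, pos x = evv u.
Proof.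
move=> ucl; have Vu : V (evv u) by apply/VP; exists u.
have uX : (evv u, cell_map (rotation T) (evv u)) \in cell_set V (rotation T).
  by apply/mem_set; exists (evv u).
by exists (SigSub uX : cell_set V (rotation T)).
Qed.

Lemma pos_op (x y : X) u : pos y = evv u ->
  pos (qop x y) = evm (code_rotation ct u) *m pos x.
Proof. by move=> yu; rewrite -rotation_evv -TE -yu. Qed.

Lemma pos_eq (x y : X) u : pos x = evv u -> pos y = evv u -> x = y.
Proof. by move=> xu yu; apply: cell_val_inj; rewrite xu yu. Qed.

Lemma code_stepP e g (x0 x1 x y : X) u v :
  pos x0 = evv e -> pos x1 = evv g ->
  code_step (code_rotation ct e) (code_rotation ct g) u = Some v ->
  pos x = evv u -> x = qop y x0 -> pos (qop y x1) = evv v.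
Proof.
move=> x0e x1g; rewrite /code_step; set c := half_code _; case: ifP => //.
rewrite -!(evv_mulP R) => /andP[/eqP cu /eqP cv] [<-] xu xy.
rewrite (pos_op _ x1g) -cv; congr (_ *m _).
have U : evm (code_rotation ct e) \in unitmx.
  rewrite -rotation_evv -TE -x0e; apply: (cell_unit VT).
  exact: (cell_setP x0).1.
(* Cancelling the invertible matrix of [x0] turns this into [pos y = evv c]. *)
have : evm (code_rotation ct e) *m pos y = evm (code_rotation ct e) *m evv c.
  by rewrite cu -xu xy (pos_op _ x0e).
by move/(congr1 (mulmx (invmx (evm (code_rotation ct e))))); rewrite !mulKmx.
Qed.

Lemma cell_trefoil_isomorphic m' (e : cvec) (gs : seq cvec)
    (words : seq (seq nat)) (rounds n : nat) :
  size gs = m'.+1 -> iso_check cl ct e gs words rounds n ->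
  quandle_isomorphic X (trefoil_quandle m'.+1).
Proof.
move=> sgs /and5P[+ ecl /allP gcl /allP ge].
move=> + /and4P[/allP eg /allP Lsome /uniq_map_inj_in Linj /allP Lcl].
rewrite !sgs in ge eg * => enum.
have [x0 x0e] := cell_point ecl.
have gs_mem i : (i < m'.+1)%N -> nth [::] gs i \in gs.
  by move=> im; rewrite mem_nth ?sgs.
have /choice[g gP] (i : 'I_m'.+1) : exists x : X, pos x = evv (nth [::] gs i).
  exact/cell_point/gcl/gs_mem.
have gx0 i : qop (g i) x0 = g (ordS i).
  apply: (pos_eq _ (gP _)); rewrite (pos_op _ x0e) gP; apply/eqP.
  by rewrite evv_mulP; apply: ge; rewrite mem_iota add0n ltn_ord.
have x0g i : qop x0 (g (ordS i)) = g i.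
  apply: (pos_eq _ (gP _)); rewrite (pos_op _ (gP _)) x0e; apply/eqP.
  have := eg i; rewrite mem_iota (nth_map [::]) ?sgs ?ltn_mod //.
  by rewrite evv_mulP add0n ltn_ord => ->.
have [F [FM F1 Fg]] := fiber_hom gx0 x0g.
(* The enumeration indexes generators by natural numbers, hence the reduction modulo m. *)
pose gam i := @fiber_gen m'.+1 (inord (i %% m'.+1)).
have gam_ord (i : 'I_m'.+1) : fiber_gen i = gam i by rewrite /gam modn_small ?inord_val.
have ordSE i : (ordS (inord (i %% m'.+1) : 'I_m'.+1) : nat) = succ_mod m'.+1 i.
  by rewrite /= inordK ?ltn_mod // /succ_mod -addn1 modnDml addn1.
have gam_rel i : (i < m'.+1)%N ->
    (gam i = gam (succ_mod m'.+1 i) * gam (pred_mod m'.+1 i))%g.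
  move=> im; have := fiber_gen_rel (inord (i %% m'.+1) : 'I_m'.+1).
  by rewrite !gam_ord /= !inordK ?ltn_mod // (modn_small im).
have [S1 SM SV] := coset_enumeration gam_rel enum.
have Sx x : exists a k, [/\ (a < n)%N, (k < size words)%N
    & x = (gam 0 ^+ a * word_val gam (nth [::] words k))%g].
  elim/fiber_ind: x => [//|x i Sx|x i Sx]; rewrite gam_ord; first exact: SM.
  exact: SV.
pose elt x := word_val gam (nseq x.1 0 ++ nth [::] words x.2)%N.
have pathP w u : code_path (code_rotation ct e)
    [seq code_rotation ct g | g <- gs] e w = Some u ->
    pos (F (word_val gam w)) = evv u.
  elim/last_ind: w u => [|w i IH] v.
    by case=> <-; rewrite /word_val big_nil F1.
  rewrite /code_path foldl_rcons -/(code_path _ _ _ w).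
  case: (code_path _ _ _ w) IH => [u|//] /(_ u erefl) IH /= stepE.
  rewrite /word_val -cats1 big_cat big_seq1 -/(word_val gam w).
  (* The image of the prefix is written as [y ** x0], the form required by [Fg] and [code_stepP]. *)
  have [f _ fK] := qop_bij x0; have := fK (F (word_val gam w)) => /= /esym Fw.
  rewrite (Fg _ _ _ Fw).
  move: stepE; rewrite size_map sgs (nth_map [::]) ?sgs ?ltn_mod // => stepE.
  by apply: (code_stepP x0e _ stepE IH Fw); rewrite gP ordSE.
have Selt x : exists2 p, p \in [seq (a, k) | a <- iota 0 n, k <- iota 0 (size words)]
    & x = elt p.
  have [a [k [an ks ->]]] := Sx x; exists (a, k).
    by apply/allpairsP; exists (a, k); rewrite /= !mem_iota.
  rewrite /elt /word_val big_cat /=; congr (_ * _)%g.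
  by elim: a {an} => [|a IH]; rewrite ?big_nil // expgS IH /= big_cons.
(* Equal images have equal normalised codes, so the index pairs of the two normal forms agree. *)
have Finj : injective F.
  move=> x y; have [p pP ->] := Selt x; have [q qP ->] := Selt y => Fpq.
  congr elt; apply: Linj => //.
  have := Lsome _ (map_f _ pP); have := Lsome _ (map_f _ qP).
  case Ep: (code_path _ _ _ _) => [u|//] _; case Eq: (code_path _ _ _ _) => [v|//] _.
  congr Some; apply/eqP; rewrite -(evv_eq R) -(pathP _ _ Ep) -(pathP _ _ Eq).
  by rewrite -/(elt p) -/(elt q) Fpq.
have Fsurj (x : X) : exists y, F y = x.
  have /VP[c ccl xc] := (cell_setP x).1; have /mapP[p pP] := Lcl c ccl.
  case E: (code_path _ _ _ _) => [u|//] /Some_inj cu.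
  exists (elt p); apply: (pos_eq _ xc); rewrite (pathP _ _ E); apply/eqP.
  by rewrite evv_eq cu.
have /choice[h hK] := Fsurj.
apply: quandle_isomorphic_sym; exists F; split; last exact: FM.
by exists h => // x; apply: Finj.
Qed.
End CellIsomorphism.

(* Solves table = [seq evi R p | p <- ?ct], instantiating ?ct. *)
Ltac encode := lazymatch goal with
  | |- [::] = _ => exact: map_nil
  | |- _ :: _ = _ => eapply map_cons_eq; [encode | encode]
  | |- (_, _) = _ => eapply evi_eq; [encode | encode]
  | |- (_ *: vec4 _ _ _ _ = _)%R => eapply vec4_half; encode
  | |- vec4 _ _ _ _ = _ => eapply vec4_full; encode
  | |- (_ *: mx4 _ = _)%R => eapply mx4_half; encode
  | |- mx4 _ = _ => eapply mx4_full; encode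
  | |- (0 = _)%R => exact: ev_0
  | |- (1 = _)%R => exact: ev_1
  | |- (2 = _)%R => exact: ev_2
  | |- (- 1 = _)%R => exact: ev_N1
  | |- golden _ = _ => exact: ev_phi
  | |- (- golden _ = _)%R => exact: ev_Nphi
  | |- ((golden _)^-1 = _)%R => exact: ev_phiV
  | |- (- (golden _)^-1 = _)%R => exact: ev_NphiV
  | |- map _ _ = _ => reflexivity
  end.

(** * Explicit data for the three cells *)

Section BaseData.
Local Open Scope ring_scope.

(* The points g_1, ..., g_m and the point e of the header, doubled as prescribed
   by the encoding, were found by exhaustive search. *)
Definition base16 : seq cvec :=
  [:: [:: (0, 0); (2, 0); (0, 0); (0, 0)];
      [:: (0, 0); (0, 0); (2, 0); (0, 0)];
      [:: (0, 0); (0, 0); (0, 0); (2, 0)]].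

Definition base24 : seq cvec :=
  [:: [:: (0, 0); (2, 0); (0, 0); (2, 0)];
      [:: (0, 0); (2, 0); (-2, 0); (0, 0)];
      [:: (0, 0); (2, 0); (0, 0); (-2, 0)];
      [:: (0, 0); (2, 0); (2, 0); (0, 0)]].

Definition base600 : seq cvec :=
  [:: [:: (1, -1); (0, 0); (0, -1); (1, 0)];
      [:: (1, -1); (0, -1); (1, 0); (0, 0)];
      [:: (1, -1); (0, 0); (0, -1); (-1, 0)];
      [:: (1, -1); (-1, 0); (0, 0); (0, 1)];
      [:: (1, -1); (-1, 0); (0, 0); (0, -1)]].

Definition origin16 : cvec := [:: (2, 0); (0, 0); (0, 0); (0, 0)].
Definition origin24 : cvec := [:: (2, 0); (2, 0); (0, 0); (0, 0)].
Definition origin600 : cvec := origin16.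
End BaseData.

(* Shortest representatives of the right cosets of the subgroup generated by
   gamma_0. *)
Definition coset_words3 : seq (seq nat) := [:: [::]; [:: 1]].
Definition coset_words4 : seq (seq nat) := [:: [::]; [:: 1]; [:: 2]; [:: 1; 1]].
Definition coset_words5 : seq (seq nat) :=
  [:: [::]; [:: 1]; [:: 2]; [:: 3]; [:: 1; 1]; [:: 1; 2]; [:: 2; 2]; [:: 3; 3];
      [:: 1; 1; 1]; [:: 1; 1; 4]; [:: 1; 2; 1]; [:: 3; 3; 2]].

Theorem theorem6p1 (R : realType) :
  [/\ quandle_isomorphic (cell16_quandle R) (trefoil_quandle 3),
      quandle_isomorphic (cell24_quandle R) (trefoil_quandle 4)
    & quandle_isomorphic (cell600_quandle R) (trefoil_quandle 5)].
Proof.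
split.
(* The last two arguments of [iso_check] are the number of deduction sweeps and the order of
   [gamma_0]; the normal forms number 4 * 2 = 8, then 6 * 4 = 24 and 10 * 12 = 120. *)
- have [ct tableE check] : exists2 ct, table16 R = [seq evi R p | p <- ct] &
      iso_check cverts16 ct origin16 base16 coset_words3 1 4.
    by eexists; [rewrite /table16; encode | vm_compute].
  exact: (cell_trefoil_isomorphic _ (@vertices16P R) tableE _ check).
- have [ct tableE check] : exists2 ct, table24 R = [seq evi R p | p <- ct] &
      iso_check cverts24 ct origin24 base24 coset_words4 2 6.
    by eexists; [rewrite /table24; encode | vm_compute].
  exact: (cell_trefoil_isomorphic _ (@vertices24P R) tableE _ check).
- have [ct tableE check] : exists2 ct, table600 R = [seq evi R p | p <- ct] &
      iso_check cverts600 ct origin600 base600 coset_words5 5 10.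
    by eexists; [rewrite /table600; encode | vm_compute].
  exact: (cell_trefoil_isomorphic _ (@vertices600P R) tableE _ check).
Qed.
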